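(* For a positive real number $s$, let $\mathscr H_{\kappa}$ denote the module tensor product $L^2_a(\mathbb D, w_{s}) \otimes_{\mathbb C[z]} L^2_a(\mathbb D, w_{s})$ of the weighted Bergman Hilbert module $L^2_a(\mathbb D, w_{s})$ with itself. Then the following hold: (1) If $s \leq 2$, then $\mathscr H_{\kappa}$ is a subnormal Hilbert module. (2) If $s \geq 6$, then $\mathscr H_{\kappa}$ is not a subnormal Hilbert module.
   Context: $\mathbb N=\{0,1,2,\dots\}$ and $\mathbb D$ is the open unit disc in $\mathbb C$. Let $\mathscr H$ be a reproducing kernel Hilbert space of holomorphic functions on $\mathbb D$ such that $zf\in\mathscr H$ whenever $f\in\mathscr H$. Then the operator $\mathscr M_z$ of multiplication by the coordinate function $z$ is bounded on $\mathscr H$, and $\mathscr H$ is a Hilbert module over $\mathbb C[z]$ with action $(p,f)\mapsto p(\mathscr M_z)f = pf$. The Hilbert module $\mathscr H$ is called subnormal if $\mathscr M_z$ is a subnormal operator, i.e. $\mathscr M_z$ has a normal extension on some Hilbert space containing $\mathscr H$. For $s>0$, $L^2_a(\mathbb D, w_s)$ is the Hilbert space of holomorphic functions on $\mathbb D$ that are square integrable with respect to $w_s\,dA$ ($dA$ is area measure), where $w_s(z)=\frac{1}{s\pi}|z|^{\frac{2(1-s)}{s}}$. The monomials $z^n$ are orthogonal in it with $\|z^n\|^2=\frac{1}{sn+1}$ $(n\in\mathbb N)$, and it is the reproducing kernel Hilbert space with kernel $\kappa_s(z,w)=\frac{s}{(1-z\overline w)^2}+\frac{1-s}{1-z\overline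 w}$. Module tensor product: for Hilbert $\mathbb C[z]$-modules $\mathscr H,\mathscr K$, $\mathscr H\otimes_{\mathbb C[z]}\mathscr K$ is obtained from the Hilbert space tensor product by dividing out the natural action of $\mathbb C[z]$ on the two factors. By a result of Salinas, $\mathscr H_{\kappa_1}\otimes_{\mathbb C[z]}\mathscr H_{\kappa_2}$ is $\mathbb C[z]$-isomorphic to the reproducing kernel Hilbert space $\mathscr H_{\kappa_1\kappa_2}$ with kernel $\kappa_1\kappa_2$ (for diagonal kernels as here), and it is identified with $\mathscr H_{\kappa_1\kappa_2}$ throughout. Thus $\mathscr H_\kappa$ is the reproducing kernel Hilbert space on $\mathbb D$ with kernel $\kappa=\kappa_{s}\kappa_{s}$; its monomials are orthogonal and $$\|z^n\|^2_{\mathscr H_{\kappa_1\kappa_2}} = \Big(\sum_{k=0}^n \frac{1}{\|z^k\|^2_{\mathscr H_{\kappa_1}}}\frac{1}{\|z^{n-k}\|^2_{\mathscr H_{\kappa_2}}}\Big)^{-1}\quad(n\in\mathbb N).$$ *)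

(* Defs.v *)
From mathcomp Require Import all_boot all_order all_algebra complex.
From mathcomp Require Import all_classical all_reals all_analysis.

Set Implicit Arguments.
Unset Strict Implicit.
Unset Printing Implicit Defensive.

Import Order.TTheory GRing.Theory Num.Theory.
Import numFieldNormedType.Exports.

Local Open Scope classical_set_scope.
Local Open Scope ring_scope.
Local Open Scope complex_scope.

(* Inner products are linear in the first argument and conjugate-linear in
   the second. *)
Record hilbertSpace (C : numClosedFieldType) := HilbertSpace {
  hilbert_sort :> completeNormedModType C ;
  inner : {dot hilbert_sort for (@Num.conj C)} ;
  sqr_norm_inner : forall x : hilbert_sort, `|x| ^+ 2 = inner x x
}.

Section Operators.
Variable C : numClosedFieldType.

Definition bounded_operator (H K : hilbertSpace C) (T : H -> K) : Prop :=
  exists c : C, forall x, `|T x| <= c * `|x|.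

Definition is_adjoint (H : hilbertSpace C) (T S : H -> H) : Prop :=
  forall x y, inner H (T x) y = inner H x (S y).

Definition normal_operator (H : hilbertSpace C) (N : {linear H -> H}) : Prop :=
  bounded_operator N /\
  exists S : {linear H -> H},
    [/\ bounded_operator S, is_adjoint N S & forall x, N (S x) = S (N x)].

(* A Hilbert space K containing H is given through an isometric embedding
   V : H -> K, so that N (V x) = V (T x) says that N extends T. *)
Definition subnormal_operator (H : hilbertSpace C) (T : {linear H -> H}) :
    Prop :=
  bounded_operator T /\
  exists (K : hilbertSpace C) (V : {linear H -> K}) (N : {linear K -> K}),
    [/\ forall x y, inner K (V x) (V y) = inner H x y,
        normal_operator N
      & forall x, N (V x) = V (T x)].

End Operators.

Section FunctionSpaces.
Variable R : realType.

Definition unit_disc : set R[i] := [set z : R[i] | `|z| < 1].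

(* A Hilbert space of holomorphic functions on the unit disc: [eval f z] is
   the value f(z). Only the values at points of the disc are relevant: two
   elements are equal as soon as their values on the disc agree. *)
Record holomorphicSpace := HolomorphicSpace {
  holomorphic_sort :> hilbertSpace R[i] ;
  eval : holomorphic_sort -> R[i]^o -> R[i]^o ;
  eval_linear : forall (a : R[i]) (f g : holomorphic_sort) (z : R[i]),
    unit_disc z -> eval (a *: f + g) z = a * eval f z + eval g z ;
  eval_inj : forall f g : holomorphic_sort,
    (forall z, unit_disc z -> eval f z = eval g z) -> f = g ;
  eval_holomorphic : forall (f : holomorphic_sort) (z : R[i]),
    unit_disc z -> derivable (eval f) z 1
}.

Definition reproducing_kernel (H : holomorphicSpace)
    (kappa : R[i] -> R[i] -> R[i]) : Prop :=
  forall w, unit_disc w ->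
    exists kw : H,
      (forall z, unit_disc z -> eval kw z = kappa z w) /\
      (forall f : H, eval f w = inner H f kw).

Definition is_coordinate_multiplication (H : holomorphicSpace)
    (M : {linear H -> H}) : Prop :=
  bounded_operator M /\
  forall (f : H) z, unit_disc z -> eval (M f) z = z * eval f z.

(* By injectivity of [eval], the operator M below is unique: it is the
   operator of multiplication by z. The module action of a polynomial p is
   p(M). *)
Definition hilbert_module (H : holomorphicSpace) : Prop :=
  exists M : {linear H -> H}, is_coordinate_multiplication M.

Definition subnormal_hilbert_module (H : holomorphicSpace) : Prop :=
  exists M : {linear H -> H},
    is_coordinate_multiplication M /\ subnormal_operator M.

(* Reproducing kernel of the weighted Bergman space L^2_a(D, w_s), where
   w_s(z) = |z|^(2(1-s)/s) / (s pi); it equals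
   \sum_n (s n + 1) (z w^* )^n. *)
Definition bergman_kernel (s : R) (z w : R[i]) : R[i] :=
  s%:C / (1 - z * Num.conj w) ^+ 2 + (1 - s)%:C / (1 - z * Num.conj w).

(* The module tensor product over C[z] of the spaces with kernels kappa1 and
   kappa2 is identified, following Salinas, with the space whose kernel is the
   pointwise product kappa1 kappa2. *)
Definition is_module_tensor_product (kappa1 kappa2 : R[i] -> R[i] -> R[i])
    (H : holomorphicSpace) : Prop :=
  reproducing_kernel H (fun z w => kappa1 z w * kappa2 z w).

End FunctionSpaces.

(* Main.v *)
From HB Require Import structures.
Require Import Defs.
From mathcomp Require Import all_boot all_order all_algebra complex.
From mathcomp Require Import all_classical all_reals all_analysis.
From mathcomp Require Import polyrcf ring lra zify.

(* The kernel is sum_n a_n (z w^* )^n with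
   a_n = (n + 1) (1 + s n + s^2 n (n - 1) / 6), so that multiplication by z is a
   weighted shift with orthogonal monomials of squared norms 1 / a_n, and it is
   subnormal iff 1 / a_n is the moment sequence of a positive measure on [0, 1].
   Up to a constant a_n is (n + 1) (n^2 + b n + c) with b = 6 / s - 1 and
   c = 6 / s^2, and s <= 2 iff b >= 2, while s >= 6 iff b <= 0.

   If s <= 2, the moment functional is positive: applied to p > 0 it gives the
   final position of a damped oscillator driven by an increasing force. A normal
   extension is then built inside the (separable) space itself, as the product of
   a bilateral shift and the Jacobi matrix of the orthogonal polynomials of the
   symmetrized functional.

   If s >= 6 and the module is subnormal, then with N a normal extension the
   numbers <(N^* N)^j (1 - N^* N)^k f, f> are nonnegative. Applied to (1 - t)^k,
   the Euler operator t d/dt turns the formula for a_n into a discrete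
   antidamped oscillator, which cannot converge as nonnegativity demands. *)
Set Implicit Arguments.
Unset Strict Implicit.
Unset Printing Implicit Defensive.

Import Order.TTheory GRing.Theory Num.Theory.
Import numFieldNormedType.Exports.

Local Open Scope classical_set_scope.
Local Open Scope ring_scope.
Local Open Scope complex_scope.

(** * Norms and limits *)

Section Norms.
Variable R : realType.
Implicit Types V W : normedZmodType R[i].

(** The norm of a space over [R[i]] takes values in [R[i]]; its real part gives access to the order
    and limits of [R]. *)
Definition nrm V (x : V) : R := complex.Re `|x|.

Lemma nrmE V (x : V) : `|x| = (nrm x)%:C.
Proof. by rewrite /nrm RRe_real // ger0_real. Qed.

Lemma nrm_ge0 V (x : V) : 0 <= nrm x.
Proof. by rewrite -ler0c -nrmE. Qed.

Lemma nrm0 V : nrm (0 : V) = 0.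
Proof. by rewrite /nrm normr0. Qed.

Lemma nrm0_eq0 V (x : V) : nrm x = 0 -> x = 0.
Proof. by move=> x0; apply/normr0_eq0; rewrite nrmE x0. Qed.

Lemma nrmD V (x y : V) : nrm (x + y) <= nrm x + nrm y.
Proof. by have := ler_normD x y; rewrite !nrmE -rmorphD lecR. Qed.

Lemma nrmN V (x : V) : nrm (- x) = nrm x.
Proof. by rewrite /nrm normrN. Qed.

Lemma nrmB V (x y : V) : nrm (x - y) = nrm (y - x).
Proof. by rewrite /nrm distrC. Qed.

Lemma nrmM (x y : R[i]) : nrm (x * y) = nrm x * nrm y.
Proof. by apply: complexI; rewrite (rmorphM (real_complex R)) -!nrmE normrM. Qed.

Lemma nrmX (x : R[i]) n : nrm (x ^+ n) = nrm x ^+ n.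
Proof. by apply: complexI; rewrite (rmorphXn (real_complex R)) /= -!nrmE normrX. Qed.

Lemma nrmV (x : R[i]) : nrm x^-1 = (nrm x)^-1.
Proof. by apply: complexI; rewrite fmorphV /= -!nrmE normfV. Qed.

Lemma nrm_real (x : R) : nrm x%:C = `|x|.
Proof.
by apply: complexI; rewrite -nrmE normc_def /= expr0n /= addr0 sqrtr_sqr.
Qed.

Lemma nrm_Re (z : R[i]) : `|complex.Re z| <= nrm z.
Proof. by rewrite -lecR -nrmE; exact: normc_ge_Re. Qed.

Lemma nrm_sqr (z : R[i]) : z * Num.conj z = (nrm z ^+ 2)%:C.
Proof. by rewrite -normCK nrmE rmorphXn. Qed.

Lemma nrm_conj (z : R[i]) : nrm (Num.conj z) = nrm z.
Proof. by rewrite /nrm norm_conjC. Qed.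

Definition hcvg V (x : nat -> V) (l : V) : Prop :=
  (fun n => nrm (x n - l)) @ \oo --> (0 : R).

Lemma le0_cvg (u v : nat -> R) : (forall n, 0 <= u n <= v n) ->
  v @ \oo --> (0 : R) -> u @ \oo --> (0 : R).
Proof.
move=> uv v0; apply: (@squeeze_cvgr _ _ _ _ (fun=> 0) v) => //.
  exact: nearW.
exact: cvg_cst.
Qed.

Lemma cvg_le (u : nat -> R) l M : u @ \oo --> l -> (forall n, u n <= M) -> l <= M.
Proof.
by move=> ul uM; apply: (ler_cvg_to ul (cvg_cst M)); exact: nearW.
Qed.

Lemma cvg_ge (u : nat -> R) l M : u @ \oo --> l -> (forall n, M <= u n) -> M <= l.
Proof.
by move=> ul uM; apply: (ler_cvg_to (cvg_cst M) ul); exact: nearW.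
Qed.

Lemma hcvg_le V (x : nat -> V) l (v : nat -> R) :
  (forall n, nrm (x n - l) <= v n) -> v @ \oo --> (0 : R) -> hcvg x l.
Proof. by move=> xv; apply: le0_cvg => n; rewrite nrm_ge0 xv. Qed.

Lemma hcvg_unique V (x : nat -> V) l m : hcvg x l -> hcvg x m -> l = m.
Proof.
move=> xl xm; apply/eqP; rewrite -subr_eq0; apply/eqP/nrm0_eq0/eqP.
rewrite eq_le nrm_ge0 andbT.
have h : (fun n => nrm (x n - l) + nrm (x n - m)) @ \oo --> (0 + 0 : R).
  exact: cvgD.
rewrite addr0 in h.
have h' : (fun=> nrm (l - m)) @ \oo --> (0 : R).
  apply: le0_cvg h => n; rewrite nrm_ge0 /= (nrmB (x n) l).
  by apply: le_trans (nrmD _ _); rewrite addrA subrK.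
have := cvg_unique (@Rhausdorff R) h' (cvg_cst (nrm (l - m))).
by move=> <-.
Qed.

Lemma hcvgD V (x y : nat -> V) l m :
  hcvg x l -> hcvg y m -> hcvg (fun n => x n + y n) (l + m).
Proof.
move=> xl ym; apply: (@hcvg_le _ _ _ (fun n => nrm (x n - l) + nrm (y n - m))).
  by move=> n; rewrite opprD addrACA nrmD.
by rewrite -[X in _ --> X]addr0; exact: cvgD.
Qed.

Lemma hcvg_lip V W (f : V -> W) (c : R) (x : nat -> V) l :
  (forall u v, nrm (f u - f v) <= c * nrm (u - v)) ->
  hcvg x l -> hcvg (fun n => f (x n)) (f l).
Proof.
move=> fc xl; apply: (@hcvg_le _ _ _ (fun n => c * nrm (x n - l))) => //.
by rewrite -[X in _ --> X](mulr0 c); apply: cvgMr.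
Qed.

Lemma hcvg_near V (x : nat -> V) l N :
  (forall n, (N <= n)%N -> x n = l) -> hcvg x l.
Proof.
move=> xl; apply: cvg_near_cst; exists N => // n /= Nn.
by rewrite xl // subrr nrm0.
Qed.

Lemma hcvg_nrm V (x : nat -> V) l :
  hcvg x l -> (fun n => nrm (x n)) @ \oo --> nrm l.
Proof.
move=> xl; apply/subr_cvg0.
have h0 : (fun n => - nrm (x n - l)) @ \oo --> (0 : R).
  by rewrite -[X in _ --> X]oppr0; exact: cvgN.
apply: (squeeze_cvgr _ h0 xl); apply: nearW => n /=.
have h1 := nrmD (x n - l) l; have h2 := nrmD (l - x n) (x n).
rewrite !subrK in h1 h2; rewrite (nrmB l) in h2.
by apply/andP; split; lra.
Qed.

Lemma complex_pos (e : R[i]) : 0 < e -> exists2 r : R, 0 < r & e = r%:C.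
Proof.
move=> e0; exists (complex.Re e); last by rewrite RRe_real ?gtr0_real.
by rewrite -ltcR RRe_real ?gtr0_real.
Qed.

End Norms.

(** * Inner products, Cauchy-Schwarz and completeness *)

Section Hilbert.
Variable R : realType.
Variable H : hilbertSpace R[i].
Local Notation ip := (inner H).
Implicit Types x y z : H.

Lemma ipDl x y z : ip (x + y) z = ip x z + ip y z.
Proof. exact: linearDl. Qed.
Lemma ipBl x y z : ip (x - y) z = ip x z - ip y z.
Proof. exact: linearBl. Qed.
Lemma ipZl a x z : ip (a *: x) z = a * ip x z.
Proof. exact: linearZl_LR. Qed.
Lemma ip0l z : ip 0 z = 0.
Proof. exact: linear0l. Qed.
Lemma ipDr x y z : ip z (x + y) = ip z x + ip z y.
Proof. exact: linearDr. Qed.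
Lemma ipBr x y z : ip z (x - y) = ip z x - ip z y.
Proof. exact: linearBr. Qed.
Lemma ipZr a x z : ip z (a *: x) = Num.conj a * ip z x.
Proof. exact: linearZr_LR. Qed.
Lemma ip0r z : ip z 0 = 0.
Proof. exact: linear0r. Qed.
Lemma ipC x y : ip y x = Num.conj (ip x y).
Proof. by rewrite (hermitian_subproof y x) expr0 mul1r. Qed.
Lemma ip_suml I (r : seq I) (P : pred I) (F : I -> H) z :
  ip (\sum_(i <- r | P i) F i) z = \sum_(i <- r | P i) ip (F i) z.
Proof. exact: linear_sumlz. Qed.
Lemma ip_sumr I (r : seq I) (P : pred I) (F : I -> H) z :
  ip z (\sum_(i <- r | P i) F i) = \sum_(i <- r | P i) ip z (F i).
Proof. exact: linear_sumr. Qed.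

Lemma ip_sqr x : ip x x = (nrm x ^+ 2)%:C.
Proof. by rewrite -sqr_norm_inner nrmE rmorphXn. Qed.

Lemma nrmZ (a : R[i]) x : nrm (a *: x) = nrm a * nrm x.
Proof.
by rewrite /nrm normrZ (nrmE a) (nrmE x) -rmorphM.
Qed.

(** Expands the squared norm of [|y|^2 x - <x, y> y], the component of x orthogonal to y, scaled to
    avoid division. *)
Lemma cauchy_schwarz x y : nrm (ip x y) <= nrm x * nrm y.
Proof.
have [y0|y0] := eqVneq y 0.
  by rewrite y0 ip0r !nrm0 mulr0.
have y1 : 0 < nrm y ^+ 2.
  by rewrite exprn_gt0 // lt_def nrm_ge0 andbT; apply: contra_neq y0 => /nrm0_eq0.
set b := ip x y.
have h : ip ((nrm y ^+ 2)%:C *: x - b *: y) ((nrm y ^+ 2)%:C *: x - b *: y) =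
  (nrm y ^+ 2 * (nrm x ^+ 2 * nrm y ^+ 2 - nrm b ^+ 2))%:C.
  rewrite ipBl !ipBr !ipZl !ipZr (ipC x y) -/b !ip_sqr.
  rewrite conj_Creal ?complex_real //.
  have := nrm_sqr b; move: (Num.conj b) => c bc.
  transitivity ((nrm y ^+ 2)%:C * ((nrm y ^+ 2)%:C * (nrm x ^+ 2)%:C - b * c)).
    by ring.
  by rewrite bc -!rmorphM -rmorphB -rmorphM mulrC [X in X - _]mulrC mulrC.
have := dnorm_ge0 (inner H) ((nrm y ^+ 2)%:C *: x - b *: y).
rewrite h ler0c pmulr_rge0 // subr_ge0 -exprMn ler_sqr ?nnegrE ?nrm_ge0 //.
by rewrite mulr_ge0 ?nrm_ge0.
Qed.

Lemma hilbert_complete (x : nat -> H) :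
  (forall e : R, 0 < e -> exists N, forall m n, (N <= m)%N -> (N <= n)%N ->
     nrm (x m - x n) < e) -> exists l, hcvg x l.
Proof.
move=> xC.
have cx : cauchy_ex (x @ \oo).
  move=> _/complex_pos[e e0 ->].
  have [N xN] := xC _ e0; exists (x N); exists N => // n /= Nn.
  by rewrite -ball_normE /ball_ /= nrmE ltcR; exact: xN.
have xl : cvg (x @ \oo) by apply/cauchy_cvgP; exact: cauchy_exP.
exists (lim (x @ \oo)); apply/cvgrPdist_lt => e e0.
have e0' : 0 < e%:C by rewrite ltcR.
have /cvgrPdist_lt/(_ _ e0') [N _ h] := xl.
exists N => // n /= Nn; rewrite sub0r normrN ger0_norm ?nrm_ge0 //.
by rewrite nrmB -ltcR -nrmE; exact: h.
Qed.
End Hilbert.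

(** * Orthonormal bases *)

Section Operators.
Variable R : realType.
Implicit Types H K L : hilbertSpace R[i].

Definition bnd H K (T : H -> K) : Prop :=
  exists c : R, forall x, nrm (T x) <= c * nrm x.

Lemma bndP H K (T : H -> K) : bounded_operator T <-> bnd T.
Proof.
split=> [[c cT]|[c cT]]; last first.
  by exists c%:C => x; rewrite !nrmE -rmorphM lecR.
exists (nrm c) => x; have := cT x; rewrite !nrmE lecE => /andP[_ /=].
move=> /le_trans; apply; case: c {cT} => a b /=.
rewrite mulr0 subr0 ler_wpM2r ?nrm_ge0 //.
exact: le_trans (ler_norm _) (nrm_Re (a +i* b)).
Qed.

Lemma bnd_comp H K L (S : {linear K -> L}) (T : {linear H -> K}) :
  bnd S -> bnd T -> bnd (S \o T).
Proof.
move=> [c bS] [d bT]; exists (`|c| * d) => x /=.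
apply: le_trans (bS _) _; rewrite -mulrA.
apply: (@le_trans _ _ (`|c| * nrm (T x))).
  by rewrite ler_wpM2r ?nrm_ge0 ?ler_norm.
by rewrite ler_wpM2l.
Qed.

Lemma hcvg_op H K (T : {linear H -> K}) x l :
  bnd T -> hcvg x l -> hcvg (fun n => T (x n)) (T l).
Proof. by move=> [c cT]; apply: (@hcvg_lip _ _ _ T c) => u v; rewrite -linearB. Qed.

Lemma hcvg_ipl H (x : nat -> H) l y :
  hcvg x l -> hcvg (fun n => inner H (x n) y) (inner H l y).
Proof.
apply: (@hcvg_lip _ _ _ (fun u => inner H u y) (nrm y)) => u v.
by rewrite -ipBl mulrC cauchy_schwarz.
Qed.

Lemma hcvg_ipr H (x : nat -> H) l y :
  hcvg x l -> hcvg (fun n => inner H y (x n)) (inner H y l).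
Proof.
apply: (@hcvg_lip _ _ _ (fun u => inner H y u) (nrm y)) => u v.
by rewrite -ipBr cauchy_schwarz.
Qed.

Lemma sum_natB (V : zmodType) (F : nat -> V) m n : (m <= n)%N ->
  \sum_(0 <= j < n) F j - \sum_(0 <= j < m) F j = \sum_(m <= j < n) F j.
Proof. by move=> mn; rewrite (big_cat_nat (leq0n m) mn) /= addrAC subrr add0r. Qed.

Lemma nrm_orthosum H (g : nat -> H) (x : nat -> R[i]) m n :
  (forall i j, i <> j -> inner H (g i) (g j) = 0) ->
  nrm (\sum_(m <= j < n) x j *: g j) ^+ 2 =
  \sum_(m <= j < n) nrm (x j) ^+ 2 * nrm (g j) ^+ 2.
Proof.
move=> og; have [nm|/subnKC <-] := ltnP n m.
  by rewrite !big_geq ?(ltnW nm) // nrm0 expr0n.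
elim: (n - m)%N => [|k IH]; first by rewrite addn0 !big_geq // nrm0 expr0n.
rewrite addnS !big_nat_recr ?leq_addr //= -IH.
set S := \sum_(m <= j < m + k) _.
have S0 : inner H S (g (m + k)%N) = 0.
  rewrite ip_suml big_nat_cond big1 // => i /andP[/andP[_ ik] _].
  by rewrite ipZl og ?mulr0 // => E; rewrite E ltnn in ik.
apply: (@complexI R); rewrite -ip_sqr ipDl !ipDr !ipZl !ipZr (ipC S (g _)) S0.
by rewrite rmorph0 !mulr0 addr0 add0r mulrA nrm_sqr !ip_sqr -rmorphM -rmorphD.
Qed.

(** By Pythagoras the squared norm of a block is at most a block of the series of [nrm (x j) ^+ 2],
    whose partial sums are increasing and bounded; so the sums are Cauchy. *)
Lemma orthosum_cvg H (g : nat -> H) (x : nat -> R[i]) (M : R) :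
  (forall i j, i <> j -> inner H (g i) (g j) = 0) ->
  (forall i, nrm (g i) <= 1) ->
  (forall n, \sum_(0 <= j < n) nrm (x j) ^+ 2 <= M) ->
  exists l, hcvg (fun n => \sum_(0 <= j < n) x j *: g j) l.
Proof.
move=> og g1 xM; pose s n := \sum_(0 <= j < n) nrm (x j) ^+ 2.
have s_nd m k : s m <= s (m + k)%N.
  elim: k => [|k IH]; first by rewrite addn0.
  by rewrite addnS /s big_nat_recr //= (le_trans IH) // lerDl sqr_ge0.
have s_cvg : cvgn s.
  apply: nondecreasing_is_cvgn; last by exists M => _ [n _ <-]; exact: xM.
  by move=> m n mn; rewrite -(subnKC mn) s_nd.
suff key e : 0 < e -> exists N, forall m n, (N <= m <= n)%N ->
    nrm (\sum_(m <= j < n) x j *: g j) < e.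
  apply: hilbert_complete => e e0; have [N hN] := key _ e0.
  exists N => m n; wlog mn : m n / (m <= n)%N.
    move=> W Nm Nn; case: (leqP m n) => mn; first exact: W.
    by rewrite nrmB; apply: W => //; exact: ltnW.
  move=> Nm Nn; rewrite nrmB sum_natB //; apply: hN.
  by rewrite Nm.
move=> e0; have e2 : 0 < e ^+ 2 by rewrite exprn_gt0.
have /cvgrPdist_lt/(_ _ e2) [N _ hN] := s_cvg.
exists N => m n /andP[Nm mn]; rewrite -(@ltr_pXn2r _ 2) ?nnegrE ?nrm_ge0 ?ltW //.
rewrite nrm_orthosum //; apply: le_lt_trans (hN _ Nm); rewrite /=.
apply: (@le_trans _ _ (s n - s m)).
  rewrite /s sum_natB //; apply: ler_sum => j _.
  by rewrite ler_piMr ?sqr_ge0 // expr_le1 ?nrm_ge0.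
rewrite (le_trans _ (ler_norm _)) // lerD2r.
by apply: nondecreasing_cvgn_le => // a b ab; rewrite -(subnKC ab) s_nd.
Qed.

End Operators.

Section Basis.
Variable R : realType.
Variable H : hilbertSpace R[i].
Variable e : nat -> H.
Hypothesis e_on : forall i j, inner H (e i) (e j) = (i == j)%:R.
Hypothesis e_complete : forall f, (forall i, inner H f (e i) = 0) -> f = 0.

Lemma onb_orth i j : i <> j -> inner H (e i) (e j) = 0.
Proof. by move=> ij; rewrite e_on; case: eqP. Qed.

Lemma onb_norm i : nrm (e i) = 1.
Proof.
have := ip_sqr (e i); rewrite e_on eqxx => /(@complexI R _ _)/esym/eqP.
by rewrite sqrp_eq1 ?nrm_ge0 // => /eqP.
Qed.

Lemma onb_norm_le1 i : nrm (e i) <= 1.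
Proof. by rewrite onb_norm. Qed.

Lemma ip_fourier f n :
  inner H f (\sum_(0 <= j < n) inner H f (e j) *: e j) =
  (\sum_(0 <= j < n) nrm (inner H f (e j)) ^+ 2)%:C.
Proof.
rewrite ip_sumr rmorph_sum; apply: eq_bigr => j _ /=.
by rewrite ipZr mulrC nrm_sqr.
Qed.

Lemma bessel f n : \sum_(0 <= j < n) nrm (inner H f (e j)) ^+ 2 <= nrm f ^+ 2.
Proof.
set S := \sum_(_ <= _ < _) _.
have h : nrm (f - \sum_(0 <= j < n) inner H f (e j) *: e j) ^+ 2 =
    nrm f ^+ 2 - S.
  apply: (@complexI R); rewrite -ip_sqr ipBl !ipBr (ipC f (\sum_(_ <= _ < _) _)).
  rewrite ip_fourier conj_Creal ?complex_real // !ip_sqr nrm_orthosum; last first.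
    exact: onb_orth.
  rewrite [X in _ - (_ - X%:C)](_ : _ = S); first by rewrite rmorphB; ring.
  by apply: eq_bigr => j _; rewrite onb_norm expr1n mulr1.
by rewrite -subr_ge0 -h sqr_ge0.
Qed.

(** Bessel gives some limit l; f - l is orthogonal to every basis vector, hence zero. *)
Lemma fourier_cvg f : hcvg (fun n => \sum_(0 <= j < n) inner H f (e j) *: e j) f.
Proof.
have [l hl] := orthosum_cvg onb_orth onb_norm_le1 (bessel f).
suff fl : f = l by rewrite {2}fl.
apply/eqP; rewrite -subr_eq0; apply/eqP/e_complete => i.
rewrite ipBl; apply/eqP; rewrite subr_eq0; apply/eqP.
apply: hcvg_unique _ (hcvg_ipl (e i) hl).
apply: (@hcvg_near _ _ _ _ i.+1) => n ni.
rewrite ip_suml (bigD1_seq i) ?mem_index_iota ?iota_uniq //= ipZl e_on eqxx mulr1.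
by rewrite big1 ?addr0 // => j ji; rewrite ipZl e_on (negPf ji) mulr0.
Qed.

(** Orthogonal images of norm at most 1 keep Fourier series convergent, by Pythagoras and Bessel.
    All operators constructed later are built from this. *)
Lemma synthesis (g : nat -> H) :
  (forall i j, i <> j -> inner H (g i) (g j) = 0) ->
  (forall i, nrm (g i) <= 1) ->
  exists T : {linear H -> H}, [/\ forall f, nrm (T f) <= nrm f,
    forall i, T (e i) = g i &
    forall f, hcvg (fun n => \sum_(0 <= j < n) inner H f (e j) *: g j) (T f)].
Proof.
move=> og g1.
have ex f : exists l, hcvg (fun n => \sum_(0 <= j < n) inner H f (e j) *: g j) l.
  exact: orthosum_cvg og g1 (bessel f).
pose T f := projT1 (cid (ex f)).
have TP f : hcvg (fun n => \sum_(0 <= j < n) inner H f (e j) *: g j) (T f).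
  exact: projT2 (cid (ex f)).
have T_lin : linear T.
  move=> a f h; apply: hcvg_unique (TP _) _.
  rewrite (_ : (fun n => _) = (fun n =>
    a *: (\sum_(0 <= j < n) inner H f (e j) *: g j) +
    \sum_(0 <= j < n) inner H h (e j) *: g j)); last first.
    apply/funext => n; rewrite scaler_sumr -big_split /=; apply: eq_bigr => j _.
    by rewrite ipDl ipZl scalerDl scalerA.
  apply: hcvgD (TP _).
  apply: (@hcvg_lip _ _ _ (fun u => a *: u) (nrm a)) (TP _) => u v.
  by rewrite -scalerBr nrmZ.
pose T' : {linear H -> H} := HB.pack T (GRing.isLinear.Build _ _ _ _ T T_lin).
exists T'; split=> [f|i|f]; last exact: TP.
- apply: (cvg_le (hcvg_nrm (TP f))) => n; rewrite -(@ler_pXn2r _ 2) ?nnegrE ?nrm_ge0 //.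
  rewrite nrm_orthosum //; apply: le_trans (bessel f n); apply: ler_sum => j _.
  by rewrite ler_piMr ?sqr_ge0 // expr_le1 ?nrm_ge0.
- apply: hcvg_unique (TP _) _; apply: (@hcvg_near _ _ _ _ i.+1) => n ni.
  rewrite (bigD1_seq i) ?mem_index_iota ?iota_uniq //= e_on eqxx scale1r.
  by rewrite big1 ?addr0 // => j ji; rewrite e_on eq_sym (negPf ji) scale0r.
Qed.

(** Passes to the limit along Fourier series, first in the second argument, then in the first. It
    reduces adjoints and isometries to a check on the basis. *)
Lemma form_ext (K K' : hilbertSpace R[i]) (T S : {linear H -> K})
    (T' S' : {linear H -> K'}) :
  bnd T -> bnd S -> bnd T' -> bnd S' ->
  (forall i j, inner K (T (e i)) (S (e j)) = inner K' (T' (e i)) (S' (e j))) ->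
  forall f h, inner K (T f) (S h) = inner K' (T' f) (S' h).
Proof.
move=> bT bS bT' bS' eq_ij.
have step i h : inner K (T (e i)) (S h) = inner K' (T' (e i)) (S' h).
  have := hcvg_ipr (T (e i)) (hcvg_op bS (fourier_cvg h)).
  have := hcvg_ipr (T' (e i)) (hcvg_op bS' (fourier_cvg h)).
  move=> h' h1; apply: hcvg_unique h1 _; rewrite (_ : (fun n => _) = (fun n =>
    inner K' (T' (e i)) (S' (\sum_(0 <= j < n) inner H h (e j) *: e j)))) //.
  apply/funext => n; rewrite (linear_sum S) (linear_sum S') !ip_sumr; apply: eq_bigr => j _.
  by rewrite !linearZZ !ipZr eq_ij.
move=> f h.
have := hcvg_ipl (S h) (hcvg_op bT (fourier_cvg f)).
have := hcvg_ipl (S' h) (hcvg_op bT' (fourier_cvg f)).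
move=> h' h1; apply: hcvg_unique h1 _; rewrite (_ : (fun n => _) = (fun n =>
  inner K' (T' (\sum_(0 <= j < n) inner H f (e j) *: e j)) (S' h))) //.
apply/funext => n; rewrite (linear_sum T) (linear_sum T') !ip_suml; apply: eq_bigr => j _.
by rewrite !linearZZ !ipZl step.
Qed.

Lemma op_ext (K : hilbertSpace R[i]) (T S : {linear H -> K}) : bnd T -> bnd S ->
  (forall i, T (e i) = S (e i)) -> forall f, T f = S f.
Proof.
move=> bT bS TS f.
apply: hcvg_unique (hcvg_op bT (fourier_cvg f)) _.
rewrite (_ : (fun n => _) = (fun n => S (\sum_(0 <= j < n) inner H f (e j) *: e j))).
  exact: hcvg_op bS (fourier_cvg f).
apply/funext => n; rewrite !linear_sum; apply: eq_bigr => j _.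
by rewrite !linearZ /= TS.
Qed.

End Basis.

(** * The moment functional *)

Section MomentFunctional.
Variable R : rcfType.
Implicit Types (s : R) (p q : {poly R}).

(** Closed form of the convolution [\sum_(k <= n) (s k + 1) (s (n - k) + 1)], the reciprocal of the
    squared norm of z^n. *)
Definition kcoef s (n : nat) : R :=
  (n%:R + 1) * (1 + s * n%:R + s ^+ 2 * (n%:R * (n%:R - 1)) / 6).

Lemma kcoef0 s : kcoef s 0 = 1.
Proof. by rewrite /kcoef; ring. Qed.

Lemma kcoef_ge1 s n : 0 < s -> 1 <= kcoef s n.
Proof.
move=> s0; rewrite /kcoef.
have n0 : 0 <= n%:R :> R by rewrite ler0n.
have n1 : 0 <= n%:R * (n%:R - 1) :> R.
  by case: n {n0} => [|n]; rewrite ?mul0r // mulr_ge0 // -natr1 addrK.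
have h1 : 0 <= s * n%:R by rewrite mulr_ge0 // ltW.
have h2 : 0 <= s ^+ 2 * (n%:R * (n%:R - 1)) / 6.
  by rewrite divr_ge0 // mulr_ge0 // sqr_ge0.
nra.
Qed.

Lemma kcoef_gt0 s n : 0 < s -> 0 < kcoef s n.
Proof. by move=> /(kcoef_ge1 n); apply: lt_le_trans. Qed.

Lemma kcoef_neq0 s n : 0 < s -> kcoef s n != 0.
Proof. by move=> /(kcoef_gt0 n)/lt0r_neq0. Qed.

Lemma kcoef_mono s n : 0 < s -> kcoef s n <= kcoef s n.+1.
Proof.
move=> s0; rewrite /kcoef -[n.+1]addn1 natrD.
have n0 : 0 <= n%:R :> R by rewrite ler0n.
rewrite -subr_ge0.
rewrite (_ : _ - _ = 1 + 2 * s * (n%:R + 1) + s ^+ 2 * (n%:R * (n%:R + 1)) / 2).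
  by rewrite !addr_ge0 ?mulr_ge0 ?sqr_ge0 ?invr_ge0 ?addr_ge0 // ltW.
by field.
Qed.

Definition diagp (c : nat -> R) p : {poly R} := \poly_(i < size p) (c i * p`_i).

Lemma coef_diagp c p i : (diagp c p)`_i = c i * p`_i.
Proof. by rewrite coef_poly; case: ltnP => // h; rewrite nth_default ?mulr0. Qed.

(** Written as the value at 1 of a rescaled polynomial because the positivity argument follows that
    polynomial along [0, 1]. *)
Definition moment s p : R := (diagp (fun i => (kcoef s i)^-1) p).[1].

Lemma diagpD c p q : diagp c (p + q) = diagp c p + diagp c q.
Proof. by apply/polyP => i; rewrite !(coef_diagp, coefD) mulrDr. Qed.

Lemma diagpZ c a p : diagp c (a *: p) = a *: diagp c p.
Proof. by apply/polyP => i; rewrite !(coef_diagp, coefZ) mulrCA. Qed.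

Lemma moment_is_linear s : scalar (moment s).
Proof. by move=> a p q; rewrite /moment diagpD diagpZ hornerD hornerZ. Qed.

HB.instance Definition _ s :=
  GRing.isLinear.Build R {poly R} R _ (moment s) (moment_is_linear s).

Lemma momentXn s n : moment s 'X^n = (kcoef s n)^-1.
Proof.
rewrite /moment (_ : diagp _ _ = (kcoef s n)^-1 *: 'X^n).
  by rewrite hornerZ hornerXn expr1n mulr1.
apply/polyP => i; rewrite coef_diagp coefZ coefXn.
by case: eqVneq => [->|]; rewrite ?mulr0.
Qed.

Lemma poly_first_root p : 0 < p.[0] -> p.[1] <= 0 ->
  exists t, [/\ 0 < t <= 1, p.[t] = 0 & forall x, 0 < x < t -> 0 < p.[x]].
Proof.
move=> p0 p1.
have pos t : t <= 1 -> (forall x, 0 < x < t -> ~~ root p x) ->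
    forall x, 0 < x < t -> 0 < p.[x].
  move=> t1 nr x /andP[x0 xt]; rewrite ltNge; apply/negP => px.
  have px0 : p.[x] < 0 by rewrite lt_neqAle px andbT; apply: nr; rewrite x0.
  have [y] : {y | y \in `]0, x[ & root p y}.
    by apply: poly_ivtoo; rewrite ?ltW // pmulr_rlt0.
  by rewrite in_itv /= => /andP[y0 yx]; apply/negP/nr; rewrite y0 (lt_trans yx).
(* Either p is zero, or it has a first root in ]0, 1[, or no root there; in the last case no sign
   change is possible, so 1 itself is the root. *)
case: (next_rootP p 0 1) => [p_eq0|y _ /eqP py|c _ _ nr].
- by rewrite p_eq0 horner0 ltxx in p0.
- rewrite in_itv /= => /andP[y0 y1] nr; exists y; split.
  + by rewrite y0 ltW.
  + exact/eqP.
  + by apply: pos; rewrite ?(ltW y1) // => x xy; apply: nr; rewrite in_itv.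
- exists 1; split => //.
  + by rewrite ltr01 lexx.
  + apply/eqP; rewrite eq_le p1 /= leNgt; apply/negP => p1'.
    have [y yI] : {y | y \in `]0, 1[ & root p y}.
      by apply: poly_ivtoo => //; rewrite pmulr_rlt0.
    by apply/negP/nr.
  + by apply: pos => // x xI; apply: nr; rewrite in_itv.
Qed.

(* In the variable u = ln t the polynomial Y solves the damped oscillator
   equation Y'' + 2g Y' + k Y = C F with the increasing force F, and V is its
   energy relative to that force. *)
Lemma moment_gt0 s p : 0 < s <= 2 -> (forall t, 0 <= t <= 1 -> 0 < p.[t]) ->
  0 < moment s p.
Proof.
move=> /andP[s0 s2] p_gt0; rewrite ltNge; apply/negP => m_le0.
pose q := diagp (fun i => (kcoef s i)^-1) p.
pose Y := 'X * q.
pose F := 'X * diagp (fun i => (i%:R + 1)^-1) p.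
(* Chosen so that [kcoef s i = (i + 1) ((i + 1) ^+ 2 + 2 g (i + 1) + k) / C]. The bound [s <= 2]
   says exactly that the damping g is nonnegative. *)
pose C : R := 6 / s ^+ 2; pose g : R := (6 / s - 3) / 2.
pose k : R := 6 / s ^+ 2 + 2 - 6 / s.
have sn0 : s != 0 by rewrite gt_eqF.
have C0 : 0 < C by rewrite divr_gt0 ?exprn_gt0.
have g0 : 0 <= g by rewrite divr_ge0 // subr_ge0 ler_pdivlMr //; lra.
have nat1 i : i%:R + 1 != 0 :> R by rewrite natr1 pnatr_eq0.
have F' : F^`() = p.
  apply/polyP => i; rewrite coef_deriv /F coefXM coef_diagp /= -[_ *+ i.+1]mulr_natr -natr1.
  by rewrite mulrAC mulVf ?nat1 // mul1r.
pose Z := 'X * Y^`().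
have ode : 'X * Z^`() + (2 * g) *: Z + k *: Y = C *: F.
  apply/polyP => -[|i]; first by rewrite /Y /F /Z !(coefD, coefZ, coefXM) /=; ring.
  have Yi : Y`_i.+1 = (kcoef s i)^-1 * p`_i by rewrite coefXM coef_diagp.
  have Zi : Z`_i.+1 = (i%:R + 1) * Y`_i.+1.
    by rewrite coefXM /= coef_deriv natr1 mulr_natl.
  have Xi : ('X * Z^`())`_i.+1 = (i%:R + 1) * Z`_i.+1.
    by rewrite coefXM /= coef_deriv natr1 mulr_natl.
  have Fi : F`_i.+1 = (i%:R + 1)^-1 * p`_i by rewrite coefXM coef_diagp.
  rewrite !coefD !coefZ Xi Zi Yi Fi.
  have := kcoef_neq0 i s0; have := nat1 i; rewrite /kcoef.
  move: (i%:R) (p`_i) => x c x1; rewrite mulf_eq0 negb_or x1 /=.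
  have -> : 1 + s * x + s ^+ 2 * (x * (x - 1)) / 6 =
      ((x + 1) ^+ 2 + 2 * g * (x + 1) + k) / C.
    by rewrite /C /g /k; field.
  rewrite mulf_eq0 negb_or => /andP[B0 _].
  have C1 : C != 0 by rewrite gt_eqF.
  clearbody C g k; field; rewrite x1 C1 /=.
  by apply: contra_neq B0; move=> ->.
have q0 : 0 < q.[0].
  rewrite horner_coef0 coef_diagp kcoef0 invr1 mul1r -horner_coef0.
  by apply: p_gt0; rewrite lexx ler01.
(* If the final position is not positive, Y returns to zero at a first time t. There V equals
   [Z ^+ 2 >= 0], and V starts at 0; yet damping and the growth of F make V decrease strictly while
   Y is positive, against the mean value theorem. *)
have [t [/andP[t0 t1] qt pos]] := poly_first_root q0 m_le0.
pose V := Z ^+ 2 + k *: Y ^+ 2 - (2 * C) *: (F * Y).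
have V0 : V.[0] = 0 by rewrite !(hornerE, hornerX) /=; ring.
have Vt : 0 <= V.[t].
  rewrite !(hornerE, hornerXn) /= qt; nra.
have [x xI] := poly_mvt V t0.
rewrite V0 !subr0 => Vx.
move: xI; rewrite in_itv /= => /andP[x0 xt].
suff : x * V^`().[x] < 0.
  rewrite pmulr_rlt0 // => Vx0.
  by move: Vt; rewrite Vx leNgt; apply/negP; rewrite negbK nmulr_rlt0.
have qx : 0 < q.[x] by apply: pos; rewrite x0.
have px : 0 < p.[x] by apply: p_gt0; rewrite !ltW //; apply: lt_le_trans t1.
have odex : x * Z^`().[x] + 2 * g * Z.[x] + k * Y.[x] = C * F.[x].
  by have := congr1 (fun P => P.[x]) ode; rewrite !(hornerD, hornerZ, hornerM, hornerX).
have Zx : Z.[x] = x * Y^`().[x] by rewrite hornerM hornerX.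
have Yx : 0 < Y.[x] by rewrite hornerM hornerX mulr_gt0.
have V'x : V^`().[x] = 2 * Z.[x] * Z^`().[x] + 2 * k * Y.[x] * Y^`().[x]
    - 2 * C * (p.[x] * Y.[x] + F.[x] * Y^`().[x]).
  rewrite /V; clearbody Z Y F.
  rewrite !expr2 !(derivB, derivD, derivZ, derivM) F'.
  rewrite !(hornerD, hornerN, hornerZ, hornerM).
  by ring.
have -> : x * V^`().[x] = - (4 * g * Z.[x] ^+ 2) - 2 * C * (x * p.[x] * Y.[x]).
  rewrite V'x; move: odex Zx.
  move: (Z^`().[x]) (Z.[x]) (Y^`().[x]) (F.[x]) (Y.[x]) (p.[x]) => z' z y' f y p'.
  move=> e1 e2; transitivity (2 * z * (x * z' + 2 * g * z + k * y - C * f)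
    - 4 * g * z ^+ 2 - 2 * C * (x * p' * y)); first by rewrite e2; ring.
  by rewrite e1; ring.
have : 0 < C * (x * p.[x] * Y.[x]) by rewrite pmulr_rgt0 // pmulr_lgt0 // mulr_gt0.
have : 0 <= g * Z.[x] ^+ 2 by rewrite mulr_ge0 // sqr_ge0.
lra.
Qed.
(** Adding a constant e > 0 makes p strictly positive and adds e to the moment, since the moment of
    1 is 1. *)
Lemma moment_ge0 s p : 0 < s <= 2 -> (forall t, 0 <= t <= 1 -> 0 <= p.[t]) ->
  0 <= moment s p.
Proof.
move=> s2 p_ge0; rewrite -oppr_le0; apply/ler_addgt0Pr => e e0; rewrite add0r.
rewrite -subr_ge0 opprK -[X in X + _]mulr1 -{1}(invr1 R) -(kcoef0 s) -momentXn.
rewrite expr0 -linearZ -linearD /= ltW //; apply: moment_gt0 => // t tI.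
by rewrite hornerD hornerZ hornerC mulr1 ltr_pwDl // p_ge0.
Qed.

(** The functional symmetrized through t = x^2: ['X^(2n)] gets the n-th moment and odd powers get 0,
    which gives a Jacobi matrix with zero diagonal. *)
Definition even_moment s q : R := moment s (even_poly q).

Lemma even_moment_is_linear s : scalar (even_moment s).
Proof. by move=> a p q; rewrite /even_moment linearP linearP. Qed.

HB.instance Definition _ s :=
  GRing.isLinear.Build R {poly R} R _ (even_moment s) (even_moment_is_linear s).

(** The even part of q at t is the mean of the values of q at the two square roots of t, both in
    [-1, 1]. *)
Lemma even_moment_ge0 s q : 0 < s <= 2 ->
  (forall x, -1 <= x <= 1 -> 0 <= q.[x]) -> 0 <= even_moment s q.
Proof.
move=> s2 q0; apply: moment_ge0 => // t /andP[t0 t1].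
have st : Num.sqrt t <= 1 by rewrite -sqrtr1 ler_sqrt.
have st0 : 0 <= Num.sqrt t by rewrite sqrtr_ge0.
have h x : q.[x] = (even_poly q).[x ^+ 2] + (odd_poly q).[x ^+ 2] * x.
  by rewrite -[in LHS](poly_even_odd q) !hornerE !horner_comp hornerXn.
have h1 := h (Num.sqrt t); have h2 := h (- Num.sqrt t).
rewrite sqrrN !sqr_sqrtr // in h1 h2.
have q1 : 0 <= q.[Num.sqrt t] by apply: q0; apply/andP; split; lra.
have q2 : 0 <= q.[- Num.sqrt t] by apply: q0; apply/andP; split; lra.
by move: q1 q2; rewrite h1 h2; lra.
Qed.

Lemma even_momentX2n s n : even_moment s 'X^(n.*2) = (kcoef s n)^-1.
Proof.
rewrite /even_moment (_ : even_poly _ = 'X^n) ?momentXn //.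
by apply/polyP => i; rewrite coef_even_poly !coefXn -!muln2 eqn_pmul2r.
Qed.

Lemma even_moment_odd s q : (forall i, ~~ odd i -> q`_i = 0) -> even_moment s q = 0.
Proof.
move=> q0; rewrite /even_moment (_ : even_poly q = 0) ?linear0 //.
by apply/polyP => i; rewrite coef_even_poly coef0 q0 // odd_double.
Qed.

End MomentFunctional.

(** * Orthogonal polynomials *)

Section OrthogonalPolynomials.
Variable R : realFieldType.
Variable l : {scalar {poly R}}.
Hypothesis l_pos : forall q : {poly R}, 0 <= l (q ^+ 2).
Hypothesis l_contr : forall q : {poly R}, l (('X * q) ^+ 2) <= l (q ^+ 2).
Hypothesis l_odd : forall q : {poly R}, (forall i, ~~ odd i -> q`_i = 0) -> l q = 0.

Lemma functionalZ c (q : {poly R}) : l (c *: q) = c * l q.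
Proof. exact: linearZ. Qed.

(* At [n = 0] the ratio is [_ / 0 = 0], so that the step also produces 'X. *)
Fixpoint opair n : {poly R} * {poly R} :=
  if n is m.+1 then
    let pq := opair m in
    (pq.2, 'X * pq.2 - (l (pq.2 ^+ 2) / l (pq.1 ^+ 2)) *: pq.1)
  else (0, 1).

Definition opol n := (opair n).2.
Definition onorm n : R := l (opol n ^+ 2).
Definition orec n : R := if n is m.+1 then onorm m.+1 / onorm m else 0.

Lemma opol0 : opol 0 = 1. Proof. by []. Qed.

(** At n = 0 the index [n.-1] is again 0, and [orec 0 = 0] removes that term. *)
Lemma opolX n : 'X * opol n = opol n.+1 + orec n *: opol n.-1.
Proof.
case: n => [|n]; last by rewrite /opol /orec /onorm /= subrK.
by rewrite /opol /= scaler0 subr0 scale0r addr0.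
Qed.

Lemma onorm_ge0 n : 0 <= onorm n.
Proof. exact: l_pos. Qed.

Lemma orec_ge0 n : 0 <= orec n.
Proof. by case: n => [|n] //=; rewrite divr_ge0 ?onorm_ge0. Qed.

Lemma opol_parity n i : odd (n + i) -> (opol n)`_i = 0.
Proof.
elim/ltn_ind: n i => -[|n] IH i.
  by rewrite opol0 coef1; case: i.
have -> : opol n.+1 = 'X * opol n - orec n *: opol n.-1 by rewrite opolX addrK.
rewrite coefB coefZ coefXM => ni.
have -> : orec n * (opol n.-1)`_i = 0.
  case: n IH ni => [|n] IH ni; first by rewrite mul0r.
  by rewrite IH ?mulr0 //; move: ni; rewrite !addSn /= negbK.
rewrite subr0; case: i ni => [|i] ni //=.
by rewrite IH //; move: ni; rewrite addnS addSn /= negbK.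
Qed.

(** One induction carries both claims because [l] is only semidefinite: where [onorm n = 0] the
    recurrence divides by zero, and monotonicity then forces [onorm n.+1 = 0] as well. *)
Lemma opol_orth_step n :
  (forall j k, (j < k <= n)%N -> l (opol j * opol k) = 0) /\
  (forall k, (k < n)%N -> onorm k.+1 <= onorm k).
Proof.
elim: n => [|n [IHo IHn]].
  by split=> // j k /andP[jk]; rewrite leqn0 => /eqP k0; rewrite k0 in jk.
have orth j : (j <= n)%N -> l (opol j * opol n.+1) = 0.
  rewrite leq_eqVlt => /predU1P[->|jn].
    apply: l_odd => i io; rewrite coefM big1 // => k _.
    have [nk|nk] := boolP (odd (n + k)); first by rewrite opol_parity ?mul0r.
    rewrite (@opol_parity n.+1) ?mulr0 //.
    have ki : (k <= i)%N by rewrite -ltnS.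
    by move: nk io; rewrite addSn /= !oddD oddB //; do 3!case: odd.
  have -> : opol n.+1 = 'X * opol n - orec n *: opol n.-1 by rewrite opolX addrK.
  rewrite mulrBr mulrCA mulrA opolX mulrDl -!scalerAl -scalerAr.
  rewrite raddfB raddfD /= !functionalZ.
  have -> : orec j * l (opol j.-1 * opol n) = 0.
    by case: j jn => [|j] jn; rewrite ?mul0r // IHo ?mulr0 // leqnn andbT ltnW.
  rewrite addr0; case: n jn IHo IHn => // n; rewrite ltnS leq_eqVlt.
  case/predU1P=> [->|jn] IHo IHn /=.
    rewrite -!expr2 -!/(onorm _).
    have [h0|h0] := eqVneq (onorm n) 0; last by rewrite divfK ?subrr.
    have : onorm n.+1 = 0.
      by apply/eqP; rewrite eq_le onorm_ge0 -{1}h0 IHn.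
    by move=> ->; rewrite !mul0r subrr.
  rewrite !IHo ?mulr0 ?subrr ?leqnn ?andbT //.
  by rewrite jn leqnSn.
split=> [j k /andP[jk]|k].
  rewrite leq_eqVlt => /predU1P[kn|kn].
    by rewrite kn; apply: orth; rewrite -ltnS -kn.
  by apply: IHo; rewrite jk.
rewrite ltnS leq_eqVlt => /predU1P[->|]; last exact: IHn.
(* Pythagoras for ['X * opol n], the orthogonal sum of [opol n.+1] and a multiple of [opol n.-1]. *)
apply: le_trans (l_contr (opol n)); rewrite opolX sqrrD -scalerAr exprZn.
rewrite !raddfD /= !functionalZ -/(onorm _) -[l (opol n.-1 ^+ 2)]/(onorm _).
rewrite [opol n.+1 * _]mulrC.
rewrite orth ?leq_pred // !mulr0 !addr0 lerDl.
by rewrite mulr_ge0 ?sqr_ge0 ?onorm_ge0.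
Qed.

Lemma opol_orth j k : l (opol j * opol k) = onorm j *+ (j == k).
Proof.
have o i m : (i < m)%N -> l (opol i * opol m) = 0.
  by move=> im; apply: (opol_orth_step m).1; rewrite im leqnn.
case: (ltngtP j k) => [/o //|/o h|->]; last by rewrite mulr1n.
by rewrite mulrC h.
Qed.

Lemma onorm_mono k : onorm k.+1 <= onorm k.
Proof. exact: (opol_orth_step k.+1).2. Qed.

Lemma onormS k : orec k.+1 * onorm k = onorm k.+1.
Proof.
rewrite /=; have [h0|h0] := eqVneq (onorm k) 0; last by rewrite divfK.
by rewrite h0 mulr0; apply/eqP; rewrite eq_le onorm_ge0 -h0 onorm_mono.
Qed.

Lemma orec_le1 k : orec k <= 1.
Proof.
case: k => [|k]; first exact: ler01.
rewrite /=; have [h0|h0] := eqVneq (onorm k) 0; first by rewrite h0 invr0 mulr0.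
have h1 : 0 < onorm k by rewrite lt_def h0 onorm_ge0.
by rewrite ler_pdivrMr // mul1r onorm_mono.
Qed.

End OrthogonalPolynomials.

(** * Normal dilation *)

Section NormalDilation.
Variable R : realType.
Variable H : hilbertSpace R[i].
Variable e : nat -> H.
Hypothesis e_on : forall i j, inner H (e i) (e j) = (i == j)%:R.
Hypothesis e_complete : forall f, (forall i, inner H f (e i) = 0) -> f = 0.

(** Relabels basis vectors by pairs, so that the space itself has room for the dilation. Indices
    coding no pair remain; operators are made zero there. *)
Definition cell (x : int * nat) : H := e (pickle x).

Lemma cell_on x y : inner H (cell x) (cell y) = (x == y)%:R.
Proof. by rewrite e_on (inj_eq (pcan_inj pickleK)). Qed.

Local Notation pinv := (@pickle_inv (int * nat)%type).
Local Notation pinvK := (@pickle_invK (int * nat)%type).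

Lemma cellP i : (exists x, e i = cell x) \/ pinv i = None.
Proof.
case h : (pickle_inv i) => [x|]; [left|by right].
by exists x; have := pinvK i; rewrite h /= /cell => ->.
Qed.

Lemma weighted_shift (w : int * nat -> R) (pi : int * nat -> int * nat) :
  (forall x, 0 <= w x <= 1) ->
  (forall x y, w x != 0 -> w y != 0 -> pi x = pi y -> x = y) ->
  exists T : {linear H -> H}, [/\ bnd T,
    forall x, T (cell x) = (w x)%:C *: cell (pi x) &
    forall i, pinv i = None -> T (e i) = 0].
Proof.
move=> w01 pi_inj.
pose g i : H := if pickle_inv i is Some x then (w x)%:C *: cell (pi x) else 0.
have og i j : i <> j -> inner H (g i) (g j) = 0.
  rewrite /g => ij.
  case hi : (pickle_inv i) => [x|]; last by rewrite ip0l.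
  case hj : (pickle_inv j) => [y|]; last by rewrite ip0r.
  rewrite ipZl ipZr cell_on.
  have [wx|wx] := eqVneq (w x) 0; first by rewrite wx mul0r.
  have [wy|wy] := eqVneq (w y) 0; first by rewrite wy rmorph0 mul0r mulr0.
  case: eqVneq => [pxy|]; last by rewrite !mulr0.
  have xy := pi_inj _ _ wx wy pxy; case: ij.
  have := pinvK i; have := pinvK j.
  by rewrite hi hj /= xy => -> ->.
have g1 i : nrm (g i) <= 1.
  rewrite /g; case: (pickle_inv i) => [x|]; last by rewrite nrm0.
  have /andP[w0 w1] := w01 x.
  by rewrite nrmZ nrm_real ger0_norm // (onb_norm e_on) mulr1.
have [T [Tb Te _]] := synthesis e_on og g1.
exists T; split=> [|x|i hi].
- by exists 1 => f; rewrite mul1r.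
- by rewrite /cell Te /g pickleK_inv.
- by rewrite Te /g hi.
Qed.

Section Jacobi.
Variable b : nat -> R.
Hypothesis b01 : forall k, 0 <= b k <= 1.
Hypothesis b0 : b 0%N = 0.

(** The bilateral shift by [d] times the symmetric Jacobi matrix with zero diagonal, as a raising
    plus a lowering shift. Since [b 0 = 0], it is harmless that [k.-1] sends both 0 and 1 to 0. *)
Lemma jacobi_shift (d : int) : exists T : {linear H -> H}, [/\ bnd T,
    forall m k, T (cell (m, k)) =
      (b k.+1)%:C *: cell (m + d, k.+1) + (b k)%:C *: cell (m + d, k.-1) &
    forall i, pinv i = None -> T (e i) = 0].
Proof.
have [] := @weighted_shift (fun x => b x.2.+1) (fun x => (x.1 + d, x.2.+1)).
- by [].
- by move=> [m k] [m' k'] /= _ _ [/addIr -> ->].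
move=> T1 [[c1 bT1] T1c T1n].
have [] := @weighted_shift (fun x => b x.2) (fun x => (x.1 + d, x.2.-1)).
- by [].
- move=> [m [|k]] [m' [|k']] //=; rewrite ?b0 ?eqxx // => _ _.
  by case=> /addIr -> ->.
move=> T2 [[c2 bT2] T2c T2n].
exists (T1 \+ T2)%R; split=> [|m k|i hi] /=.
- by exists (c1 + c2) => x; rewrite mulrDl (le_trans (nrmD _ _)) ?lerD.
- by rewrite T1c T2c.
- by rewrite T1n // T2n // addr0.
Qed.

(** The adjoint is the same Jacobi matrix with the opposite shift: the matrix is symmetric, the
    shift unitary, and the two commute. *)
Lemma jacobi_normal : exists N : {linear H -> H}, normal_operator N /\
  forall m k, N (cell (m, k)) =
      (b k.+1)%:C *: cell (m + 1, k.+1) + (b k)%:C *: cell (m + 1, k.-1).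
Proof.
have [N [bN Nc Nn]] := jacobi_shift 1.
have [S [bS Sc Sn]] := jacobi_shift (-1).
exists N; split=> //; split; first exact/bndP.
exists S; split; first exact/bndP.
- have bid : bnd (@idfun H) by exists 1 => x; rewrite mul1r.
  apply: (@form_ext _ _ _ e_on e_complete _ _ N idfun idfun S bN bid bid bS) => i j /=.
  case: (cellP i) => [[[m k] ->]|hi]; last first.
    rewrite Nn // ip0l; case: (cellP j) => [[[m k] ->]|hj]; last first.
      by rewrite Sn // ip0r.
    rewrite Sc ipDr !ipZr.
    have h x : inner H (e i) (cell x) = 0.
      by rewrite e_on; case: eqP => // ix; rewrite ix pickleK_inv in hi.
    by rewrite !h !mulr0 addr0.
  case: (cellP j) => [[[m' k'] ->]|hj]; last first.
    rewrite Sn // ip0r Nc ipDl !ipZl.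
    have h x : inner H (cell x) (e j) = 0.
      by rewrite e_on; case: eqP => // jx; rewrite -jx pickleK_inv in hj.
    by rewrite !h !mulr0 addr0.
  rewrite Nc Sc ipDl ipDr !ipZl !ipZr !cell_on !xpair_eqE.
  rewrite !conj_Creal ?complex_real //.
  have -> : (m == m' - 1) = (m + 1 == m') by lia.
  case: (m + 1 == m') => /=; last by rewrite !mulr0.
  rewrite addrC; congr (_ + _).
    case: k => [|k] /=; last by rewrite eqSS; case: eqVneq => [->|]; rewrite ?mulr0.
    by rewrite b0 mul0r mulr0.
  case: k' => [|k'] /=; first by rewrite b0 mul0r mulr0.
  by rewrite eqSS; case: eqVneq => [->|]; rewrite ?mulr0.
- apply: (op_ext e_on e_complete (bnd_comp bN bS) (bnd_comp bS bN)) => i /=.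
  case: (cellP i) => [[[m k] ->]|hi]; last by rewrite Nn // Sn // !linear0.
  rewrite Nc Sc !linearD !linearZZ !Nc !Sc.
  by have -> : m - 1 + 1 = m + 1 - 1 by lia.
Qed.
End Jacobi.

Variable l : {scalar {poly R}}.
Hypothesis l_pos : forall q : {poly R}, 0 <= l (q ^+ 2).
Hypothesis l_contr : forall q : {poly R}, l (('X * q) ^+ 2) <= l (q ^+ 2).
Hypothesis l_odd : forall q : {poly R}, (forall i, ~~ odd i -> q`_i = 0) -> l q = 0.

Local Notation p := (opol l).
Local Notation h := (onorm l).

Definition ocell m k : H := (Num.sqrt (h k))%:C *: cell (m, k).

(* [rep m v q]: the vector v at level m stands for the polynomial q under the
   isometry taking the k-th orthogonal polynomial to [ocell m k]. *)
Inductive rep m : H -> {poly R} -> Prop :=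
| rep0 : rep m 0 0
| repD a k v q : rep m v q -> rep m (v + a%:C *: ocell m k) (q + a *: p k).

Lemma ip_ocell m k m' k' : inner H (ocell m k) (ocell m' k') =
  (l (p k * p k') *+ (m == m'))%:C.
Proof.
rewrite opol_orth // ipZl ipZr cell_on xpair_eqE conj_Creal ?complex_real //.
case: (m == m'); last by rewrite !mulr0.
case: eqVneq => [->|]; last by rewrite !mulr0.
rewrite mulr1 mulr1n -rmorphM -expr2 sqr_sqrtr //; exact: onorm_ge0.
Qed.

Lemma ip_rep m v q m' v' q' : rep m v q -> rep m' v' q' ->
  inner H v v' = (l (q * q') *+ (m == m'))%:C.
Proof.
move=> r r'; elim: r => [|a k {}v {}q _ IH]; first by rewrite ip0l mul0r linear0 mul0rn.
rewrite ipDl IH mulrDl linearD mulrnDl rmorphD; congr (_ + _).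
rewrite ipZl -scalerAl linearZ /= -mulrnAr rmorphM; congr (_ * _).
clear IH; elim: r' => [|a' k' {}v' {}q' _ IH']; first by rewrite ip0r mulr0 linear0 mul0rn.
rewrite ipDr IH' mulrDr linearD mulrnDl rmorphD; congr (_ + _).
rewrite ipZr ip_ocell conj_Creal ?complex_real // -scalerAr linearZ /=.
by rewrite -mulrnAr rmorphM.
Qed.

Lemma rep_add m v q v' q' : rep m v q -> rep m v' q' -> rep m (v + v') (q + q').
Proof.
move=> r; elim=> [|a k {}v' {}q' _ IH]; first by rewrite !addr0.
by rewrite !addrA; exact: repD.
Qed.

Lemma rep_cell m a k : rep m (a%:C *: ocell m k) (a *: p k).
Proof. by rewrite -[_ *: ocell _ _]add0r -[_ *: p k]add0r; apply: repD; exact: rep0. Qed.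

(** The vector [xi] stands for the polynomial 1 at level 0, and [N] multiplies by ['X] while raising
    the level. So [iter i N xi] stands for ['X^i] at level i; distinct levels are orthogonal, and
    [l] gives the products within a level. *)
Lemma normal_dilation : exists (N : {linear H -> H}) (xi : H), normal_operator N /\
  forall i j, inner H (iter i N xi) (iter j N xi) = (l 'X^(i + j) *+ (i == j))%:C.
Proof.
(* Square roots of the recurrence coefficients make the matrix symmetric; on the vectors [ocell] it
   becomes the recurrence of [opol] again. *)
pose b k := Num.sqrt (orec l k).
have b01 k : 0 <= b k <= 1.
  by rewrite sqrtr_ge0 -[leRHS]sqrtr1 ler_sqrt ?ltr01 // orec_le1.
have b0 : b 0%N = 0 by rewrite /b /= sqrtr0.
have [N [nN Nc]] := jacobi_normal b01 b0.
have No m k : N (ocell m k) = ocell (m + 1) k.+1 + (orec l k)%:C *: ocell (m + 1) k.-1.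
  rewrite /ocell linearZZ Nc scalerDr !scalerA; congr (_ *: _ + _ *: _).
    by rewrite -rmorphM /b mulrC -sqrtrM ?orec_ge0 // onormS.
  rewrite -!rmorphM /b; congr (_%:C); case: k => [|k].
    by rewrite /= sqrtr0 mulr0 mul0r.
  rewrite -(onormS l_pos l_contr l_odd) sqrtrM ?orec_ge0 // mulrAC.
  by rewrite -expr2 sqr_sqrtr ?orec_ge0.
have rN m v q : rep m v q -> rep (m + 1) (N v) ('X * q).
  elim=> [|a k {}v {}q _ IH]; first by rewrite linear0 mulr0; exact: rep0.
  rewrite linearD linearZZ No mulrDr -scalerAr opolX.
  apply: rep_add IH _; rewrite [a *: (p k.+1 + _)]scalerDr.
  rewrite [a%:C *: (ocell _ k.+1 + _)]scalerDr.
  apply: rep_add; first exact: rep_cell.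
  have -> : a *: (orec l k *: p k.-1) = (a * orec l k) *: p k.-1 by exact: scalerA.
  have -> : a%:C *: ((orec l k)%:C *: ocell (m + 1) k.-1) =
    (a * orec l k)%:C *: ocell (m + 1) k.-1 by rewrite rmorphM; exact: scalerA.
  exact: rep_cell.
exists N, (ocell 0 0); split=> // i j.
have rX n : rep n%:Z (iter n N (ocell 0 0)) 'X^n.
  elim: n => [|n IH].
    by have := rep_cell 0 1 0; rewrite !scale1r.
  by rewrite exprS -[n.+1]addn1 PoszD addn1; exact: rN.
by rewrite (ip_rep (rX i) (rX j)) -exprD eqz_nat.
Qed.

End NormalDilation.

(** * Differences along a normal operator *)

Section NormalDifferences.
Variable R : realType.

(* By AM-GM a log-convex sequence is convex. *)
Lemma logconvex_bounded (x : nat -> R) (M : R) : (forall n, 0 <= x n <= M) ->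
  (forall n, x n.+1 ^+ 2 <= x n * x n.+2) -> x 1%N <= x 0%N.
Proof.
move=> xM lc; rewrite leNgt; apply/negP => x01.
have cv n : x n.+1 *+ 2 <= x n + x n.+2.
  have /andP[x0 _] := xM n; have /andP[x1 _] := xM n.+1.
  have /andP[x2 _] := xM n.+2; have := lc n.
  move: (x n) (x n.+1) (x n.+2) x0 x1 x2 => a b c a0 b0 c0 bac.
  rewrite -(@ler_pXn2r _ 2) ?nnegrE ?mulrn_wge0 ?addr_ge0 //.
  have := sqr_ge0 (a - c); rewrite -mulr_natl; nra.
have inc n : x 1%N - x 0%N <= x n.+1 - x n.
  elim: n => // n /le_trans; apply; have := cv n; rewrite mulr2n; lra.
have lin n : x 0%N + n%:R * (x 1%N - x 0%N) <= x n.
  elim: n => [|n IH]; first by rewrite mul0r addr0.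
  by have := inc n; rewrite -natr1; lra.
set d := x 1%N - x 0%N in inc lin; have d0 : 0 < d by rewrite subr_gt0.
have [n hn] : exists n, M / d < n%:R.
  exists (Num.truncn (M / d)).+1.
  by rewrite truncnS_gt.
rewrite ltr_pdivrMr // in hn.
have := lin n; have /andP[_ h1] := xM n; have /andP[h0 _] := xM 0%N; lra.
Qed.

Variable K : hilbertSpace R[i].
Variables N S : {linear K -> K}.
Hypothesis bN : bnd N.
Hypothesis adjNS : is_adjoint N S.
Hypothesis NS : forall x, N (S x) = S (N x).

Local Notation A x := (S (N x)).
Local Notation B := (fun x => x - A x).

Lemma ip_modl x y : inner K (A x) y = inner K (N x) (N y).
Proof. by rewrite (ipC y) -adjNS -ipC. Qed.

Lemma ip_modr x y : inner K x (A y) = inner K (N x) (N y).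
Proof. by rewrite -adjNS. Qed.

(** Singles out the vectors whose spectral measure for [S N] lives on [0, 1], without recourse to
    the spectral theorem. *)
Definition bounded_orbit (h : K) := exists M, forall m, nrm (iter m (fun x => A x) h) <= M.

Lemma iter_modN m h : iter m (fun x => A x) (N h) = N (iter m (fun x => A x) h).
Proof. by elim: m => //= m ->; rewrite NS. Qed.

Lemma bounded_orbitN h : bounded_orbit h -> bounded_orbit (N h).
Proof.
case: bN => c cN [M hM]; exists (`|c| * M) => m; rewrite iter_modN.
apply: le_trans (cN _) _; apply: (@le_trans _ _ (`|c| * nrm (iter m (fun x => A x) h))).
  by rewrite ler_wpM2r ?nrm_ge0 ?ler_norm.
by rewrite ler_wpM2l.
Qed.

Lemma bounded_orbitB h : bounded_orbit h -> bounded_orbit (B h).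
Proof.
case=> M hM; exists (M + M) => m.
have -> : iter m (fun x => A x) (B h) =
    iter m (fun x => A x) h - iter m.+1 (fun x => A x) h.
  by elim: m => //= m ->; rewrite !linearB.
by apply: le_trans (nrmD _ _) _; rewrite nrmN lerD.
Qed.

(** By Cauchy-Schwarz the norms of [(S N)^n h] are log-convex; being bounded, they cannot start by
    growing. Hence [|N h|^2 = <S N h, h> <= |h|^2]. *)
Lemma bounded_orbit_contr h : bounded_orbit h -> nrm (N h) <= nrm h.
Proof.
case=> M hM; pose x n := nrm (iter n (fun x => A x) h).
have x10 : x 1%N <= x 0%N.
  apply: (@logconvex_bounded x M) => n; first by rewrite nrm_ge0 hM.
  apply: le_trans (cauchy_schwarz _ _).
  rewrite /= ip_modr -ip_modl -/(iter n.+1 _ _) ip_sqr nrm_real.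
  by rewrite ger0_norm ?sqr_ge0.
rewrite -(@ler_pXn2r _ 2) ?nnegrE ?nrm_ge0 //.
apply: (@le_trans _ _ (nrm (inner K (A h) h))).
  by rewrite ip_modl ip_sqr nrm_real ger0_norm ?sqr_ge0.
apply: le_trans (cauchy_schwarz _ _) _.
by rewrite expr2 ler_wpM2r ?nrm_ge0.
Qed.

(** Induction in steps of two: one self-adjoint factor [1 - S N] moves across and h becomes
    [(1 - S N) h]. The case k = 1 is the contraction estimate. *)
Lemma iterB_ge0 k h : bounded_orbit h -> 0 <= complex.Re (inner K (iter k B h) h).
Proof.
have Bsa x y : inner K (B x) y = inner K x (B y).
  by rewrite ipBl ipBr ip_modl ip_modr.
elim/ltn_ind: k h => -[|[|k]] IH h hb.
- by rewrite /= ip_sqr /= sqr_ge0.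
- rewrite /= ipBl ip_modl !ip_sqr -rmorphB /= subr_ge0.
  by rewrite ler_pXn2r ?nnegrE ?nrm_ge0 // bounded_orbit_contr.
- rewrite iterS Bsa iterSr.
  by apply: IH => //; exact: bounded_orbitB.
Qed.

Lemma iterB_S k h : inner K (iter k.+1 B h) h =
  inner K (iter k B h) h - inner K (iter k B (N h)) (N h).
Proof.
rewrite iterS ipBl ip_modl; congr (_ - inner K _ _).
by elim: k => //= k IH; rewrite linearB IH NS.
Qed.

End NormalDifferences.

(** This is [(-1)^k] times the k-th forward difference at j; for moments of a measure it is the
    integral of [t^j (1 - t)^k]. *)
Fixpoint difference (V : zmodType) (c : nat -> V) k j : V :=
  if k is k'.+1 then difference c k' j - difference c k' j.+1 else c j.

(** The squared norm of [(S N)^m f] is [c (m + m)], so f has a bounded orbit, and the differences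
    are the forms [<(1 - S N)^k N^j f, N^j f>]. *)
Lemma normal_difference_ge0 (R : realType) (K : hilbertSpace R[i])
    (N : {linear K -> K}) (f : K) (c : nat -> R) : normal_operator N ->
  (forall n, inner K (iter n N f) (iter n N f) = (c n)%:C) ->
  (exists M, forall n, c n <= M) ->
  forall k j, 0 <= difference c k j.
Proof.
case=> /bndP bN [S [_ adjNS NS]] Nc [M cM] k j.
have fb : bounded_orbit N S f.
  exists (1 + M) => m.
  have Am n y x : inner K (iter n (fun x => S (N x)) x) y =
      inner K (iter n N x) (iter n N y).
    elim: n x y => // n IH x y.
    by rewrite iterS (ip_modl adjNS) -iter_modN // IH -!iterSr.
  have Am' n y x : inner K x (iter n (fun x => S (N x)) y) =
      inner K (iter n (fun x => S (N x)) x) y.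
    by rewrite ipC !Am -ipC.
  have h : nrm (iter m (fun x => S (N x)) f) ^+ 2 = c (m + m)%N.
    apply: (@complexI R); rewrite -ip_sqr -Nc -Am iterD.
    exact: Am'.
  have := cM (m + m)%N; rewrite -h; have := nrm_ge0 (iter m (fun x => S (N x)) f).
  have := sqr_ge0 (nrm (iter m (fun x => S (N x)) f) - 1).
  by move: (nrm _) => x; nra.
have -> : difference c k j = complex.Re
    (inner K (iter k (fun x => x - S (N x)) (iter j N f)) (iter j N f)).
  elim: k j => [|k IH] j; first by rewrite /= Nc.
  by rewrite (iterB_S adjNS NS) /= !IH -raddfB.
apply: iterB_ge0 => //.
by elim: j => //= j IH; exact: bounded_orbitN.
Qed.

(** * The discrete oscillator *)

Section EulerOperator.
Variable R : realType.
Implicit Types (s : R) (p : {poly R}).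

Definition euler p : {poly R} := 'X * p^`().

Lemma euler_is_linear : linear euler.
Proof. by move=> a p q; rewrite /euler linearP /= mulrDr scalerAr. Qed.

HB.instance Definition _ :=
  GRing.isLinear.Build R {poly R} {poly R} _ euler euler_is_linear.

Lemma coef_euler p i : (euler p)`_i = i%:R * p`_i.
Proof.
by rewrite coefXM; case: i => [|i] /=; rewrite ?mul0r // coef_deriv mulr_natl.
Qed.

Definition eulerS p := p + euler p.

Lemma eulerS_is_linear : linear eulerS.
Proof. by move=> a p q; rewrite /eulerS linearP scalerDr addrACA. Qed.

HB.instance Definition _ :=
  GRing.isLinear.Build R {poly R} {poly R} _ eulerS eulerS_is_linear.

Lemma euler_eulerS p : euler (eulerS p) = eulerS (euler p).
Proof. exact: linearD. Qed.

(** The operator multiplies ['X^i] by [(i + 1) (i^2 + (6 / s - 1) i + 6 / s^2)], that is by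
    [6 / s^2] times [kcoef s i]; this cancels the weight of the moment and leaves evaluation at
    1. *)
Lemma moment_euler s p : 0 < s ->
  moment s (euler (euler (eulerS p)) + (6 / s - 1) *: euler (eulerS p)
    + (6 / s ^+ 2) *: eulerS p) = 6 / s ^+ 2 * p.[1].
Proof.
move=> s0; set q := _ + _ + _.
have qE : diagp (fun i => (kcoef s i)^-1) q = (6 / s ^+ 2) *: p.
  apply/polyP => i; rewrite coef_diagp /q !(coefD, coefZ, coef_euler).
  have := kcoef_neq0 i s0; rewrite /kcoef.
  have sn0 : s != 0 by rewrite gt_eqF.
  move: (i%:R) (p`_i) => x c; rewrite mulf_eq0 negb_or => /andP[x1 B0].
  rewrite [X in _ * X](_ : _ = 6 / s ^+ 2 * ((x + 1) *
    (1 + s * x + s ^+ 2 * (x * (x - 1)) / 6)) * c); last by field.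
  set K := (x + 1) * _; have K0 : K != 0 by rewrite mulf_neq0.
  by rewrite (mulrC (6 / s ^+ 2)) -(mulrA K) mulKf.
by rewrite /moment qE hornerZ.
Qed.

Definition ypow (k : nat) : {poly R} := (1 - 'X) ^+ k.

Lemma eulerX i k : euler ('X^i * ypow k) =
  i%:R *: ('X^i * ypow k) - k%:R *: ('X^(i.+1) * ypow k.-1).
Proof.
rewrite /euler /ypow derivM derivXn deriv_exp derivB derivX derivC sub0r.
rewrite mulrDr !scaler_nat -mulNrn; congr (_ + _).
  case: i => [|i]; first by rewrite !mulr0n mul0r mulr0.
  by rewrite mulrnAl mulrnAr /=; congr (_ *+ _); rewrite exprS; ring.
by rewrite !mulrnAr; congr (_ *+ _); rewrite exprS; ring.
Qed.

(** Writing t as 1 - (1 - t) turns the derivative into a difference in the exponent, so differential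
    equations become recurrences in k. *)
Lemma euler_ypow k : euler (ypow k.+1) = k.+1%:R *: (ypow k.+1 - ypow k).
Proof.
have := eulerX 0 k.+1; rewrite expr0 mul1r => ->; rewrite scale0r sub0r /=.
by rewrite -scalerN expr1 /ypow exprS; congr (_ *: _); ring.
Qed.

Lemma euler_eulerS_ypow k : euler (eulerS (ypow k.+1)) =
  k.+1%:R *: (eulerS (ypow k.+1) - eulerS (ypow k)).
Proof.
by rewrite euler_eulerS euler_ypow [LHS]linearZZ; congr (_ *: _); rewrite linearB.
Qed.

Lemma moment_difference s j k :
  moment s ('X^j * ypow k) = difference (fun n => (kcoef s n)^-1) k j.
Proof.
elim: k j => [|k IH] j; first by rewrite /ypow mulr1 momentXn.
rewrite /= -!IH -linearB; congr moment.
by rewrite /ypow !exprS; ring.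
Qed.

(** Position [Gseq] and velocity [Aseq] of a discrete oscillator with time ln k. *)
Definition Gseq s k := moment s (eulerS (ypow k)).
Definition Aseq s k := moment s (euler (eulerS (ypow k))).

Lemma Gseq0 s : Gseq s 0 = 1.
Proof.
rewrite /Gseq /eulerS /euler /ypow expr0 derivC mulr0 addr0.
by have := momentXn s 0; rewrite expr0 => ->; rewrite kcoef0 invr1.
Qed.

Lemma Gseq_rec s k : k.+1%:R * (Gseq s k.+1 - Gseq s k) = Aseq s k.+1.
Proof.
rewrite /Gseq /Aseq -linearB -linearZ /=; congr moment.
by rewrite euler_eulerS_ypow.
Qed.

(** This is [moment_euler] at [(1 - t)^(k + 1)], which vanishes at 1. For [6 <= s] the velocity has
    a nonnegative coefficient: antidamping. *)
Lemma Aseq_rec s k : 0 < s -> k.+1%:R * (Aseq s k.+1 - Aseq s k) =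
  (1 - 6 / s) * Aseq s k.+1 - 6 / s ^+ 2 * Gseq s k.+1.
Proof.
move=> s0; have := moment_euler (ypow k.+1) s0.
have mE (u v w : {poly R}) (b c : R) : moment s (u + b *: v + c *: w) =
    moment s u + b * moment s v + c * moment s w by rewrite !linearD !linearZ.
have y1 : (ypow k.+1).[1] = 0 by rewrite /ypow !hornerE subrr expr0n.
rewrite y1 mulr0 mE.
have -> : moment s (euler (euler (eulerS (ypow k.+1)))) =
    k.+1%:R * (Aseq s k.+1 - Aseq s k).
  rewrite /Aseq -linearB -linearZ /=; congr moment.
  by rewrite [in LHS]euler_eulerS_ypow linearZZ; congr (_ *: _); rewrite linearB.
rewrite -/(Aseq s k.+1) -/(Gseq s k.+1); lra.
Qed.

Local Notation D s := (difference (fun n => (kcoef s n)^-1)).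

Lemma GseqE s k : Gseq s k = D s k 0 - k%:R * D s k.-1 1.
Proof.
rewrite /Gseq /eulerS -!moment_difference linearD expr0 !mul1r.
have := eulerX 0 k; rewrite expr0 mul1r => ->.
by rewrite scale0r sub0r linearN linearZ.
Qed.

Lemma AseqE s k :
  Aseq s k = (k * k.-1)%:R * D s k.-2 2 - 2 * (k%:R * D s k.-1 1).
Proof.
rewrite /Aseq -!moment_difference.
set a := 'X^1 * _; set b := 'X^2 * _.
have Ea : euler a = a - k.-1%:R *: b by rewrite eulerX scale1r.
have Ey : euler (ypow k) = - k%:R *: a.
  have := eulerX 0 k; rewrite expr0 mul1r => ->.
  by rewrite scale0r sub0r scaleNr.
have -> : euler (eulerS (ypow k)) = (k * k.-1)%:R *: b + (- (2 * k%:R)) *: a.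
  rewrite euler_eulerS Ey /eulerS [euler (_ *: _)]linearZZ /= Ea natrM.
  clearbody a b.
  by apply/polyP => i; rewrite !(coefD, coefZ, coefN); ring.
have mE (u v : {poly R}) (x y : R) :
  moment s (x *: u + y *: v) = x * moment s u + y * moment s v.
  by rewrite linearD !linearZ.
by rewrite mE; ring.
Qed.

End EulerOperator.

(** * Convex decreasing sequences and logarithmic growth *)

Section Limits.
Variable R : realType.
Implicit Types u v : nat -> R.

Lemma cvg_half u (l : R) : u @ \oo --> l -> (fun k => u k./2) @ \oo --> l.
Proof.
move=> ul; apply: (@cvg_comp _ _ _ (fun k => k./2) u \oo \oo) ul => A [N _ hN].
exists N.*2 => // n /= Nn; apply: hN => /=.
by rewrite geq_half_double.
Qed.

Lemma mul_difference_le u k m :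
  (forall k, u k.+1 - u k.+2 <= u k - u k.+1) ->
  m%:R * (u (k + m)%N - u (k + m).+1) <= u k - u (k + m)%N.
Proof.
move=> du; elim: m => [|m IH]; first by rewrite mul0r addn0 subrr.
have := du (k + m)%N; rewrite addnS -natr1 => h.
have := ler_wpM2l (ler0n R m) h; lra.
Qed.

(** The decrements decrease, so k times the k-th one is controlled by the total drop between k/2 and
    k, which tends to 0. *)
Lemma cvg_mul_difference u (g : R) :
  (forall k, 0 <= u k.+1 - u k.+2 <= u k - u k.+1) -> u @ \oo --> g ->
  (fun k => k.+1%:R * (u k - u k.+1)) @ \oo --> (0 : R).
Proof.
move=> du ug.
have d0 k : 0 <= u k - u k.+1.
  by have /andP[/le_trans h1 /h1] := du k.
apply: (@le0_cvg _ _ (fun k => 2 * (u k./2 - u k) + (u k - u k.+1))) => [k|].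
  rewrite mulr_ge0 //=.
  have du' i : u i.+1 - u i.+2 <= u i - u i.+1 by have /andP[] := du i.
  have := mul_difference_le k./2 (k - k./2) du'; rewrite subnKC; last by lia.
  have : k%:R <= 2 * (k - k./2)%:R :> R.
    by rewrite -natrM ler_nat; lia.
  by have := d0 k; rewrite -natr1; nra.
have uS : (fun k => u k.+1) @ \oo --> g by rewrite (cvg_shiftS u).
have -> : 0 = 2 * (g - g) + (g - g) :> R by rewrite !subrr mulr0 addr0.
apply: cvgD; last exact: cvgB.
by apply: cvgMr; apply: cvgB => //; exact: cvg_half.
Qed.

(** From n to 2n the sequence falls by at least d / 2, in n steps of at least [d / (2 n)] each,
    while convergence keeps it within d / 8 of 0. *)
Lemma log_growth (A : nat -> R) (d : R) K : 0 < d ->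
  (forall k, (K <= k)%N -> k.+1%:R * (A k.+1 - A k) <= - d) ->
  ~ A @ \oo --> (0 : R).
Proof.
move=> d0 hK A0; have e0 : 0 < d / 8 by lra.
have /cvgrPdist_lt/(_ _ e0) [N _ hN] := A0.
pose n := (maxn K N).+1.
have step m : (m <= n)%N -> m%:R * d <= 2 * n%:R * (A n - A (n + m)%N).
  elim: m => [|m IH] mn; first by rewrite mul0r addn0 subrr mulr0.
  have := hK (n + m)%N; rewrite addnS => /(_ ltac:(lia)) h.
  have nm : (n + m).+1%:R <= 2 * n%:R :> R by rewrite -natrM ler_nat; lia.
  have nm0 : 0 < (n + m).+1%:R :> R by rewrite ltr0n.
  have := IH (ltnW mn); rewrite -natr1.
  move: (n + m).+1%:R (A (n + m).+1) (A (n + m)%N) nm nm0 h => x a b xn x0 h.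
  nra.
have := step n (leqnn _); rewrite -mulrA [2 * _]mulrC -mulrA ler_pM2l ?ltr0n //.
have := hN n ltac:(rewrite /= /n; lia); have := hN (n + n)%N ltac:(rewrite /= /n; lia).
rewrite !sub0r !normrN !ltr_norml => /andP[h1 h2] /andP[h3 h4]; lra.
Qed.

End Limits.

(** * Failure of complete monotonicity for s >= 6 *)

Section NotCompletelyMonotone.
Variable R : realType.

Local Notation D s := (difference (fun n => (kcoef s n)^-1)).

(** The limit g of [D s k 0] is the mass at t = 0 of a representing measure. The remaining terms of
    [GseqE] and [AseqE] vanish in the limit by convexity. *)
Lemma difference_limits (s : R) : (forall k j, 0 <= D s k j) ->
  exists2 g : R, Gseq s @ \oo --> g & 0 <= g /\ Aseq s @ \oo --> (0 : R).
Proof.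
move=> D0.
have D1 k j : D s k j.+1 = D s k j - D s k.+1 j by rewrite /=; ring.
have a_cvg : cvgn (fun k => D s k 0).
  apply: nonincreasing_is_cvgn; last by exists 0 => _ [n _ <-]; exact: D0.
  apply/nonincreasing_seqP => k.
  by rewrite -subr_ge0 -D1.
set g := lim _ in a_cvg *.
have b_cvg : (fun k => k.+1%:R * D s k 1) @ \oo --> (0 : R).
  rewrite (_ : (fun k => _) = (fun k => k.+1%:R * (D s k 0 - D s k.+1 0))).
    apply: cvg_mul_difference a_cvg => k.
    rewrite -!D1; apply/andP; split; first exact: D0.
    by rewrite -subr_ge0 -D1; exact: D0.
  by apply/funext => k; rewrite -D1.
have b'_cvg : (fun k => k%:R * D s k.-1 1) @ \oo --> (0 : R).
  by rewrite -(cvg_shiftS (fun k => k%:R * D s k.-1 1)).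
(* The halving argument once more, now on the first differences: it bounds the quadratic multiple of
   the second difference at k by a linear multiple of the first difference at k/2. *)
have c_cvg : (fun k => (k * k.-1)%:R * D s k.-2 2) @ \oo --> (0 : R).
  rewrite -(cvg_shiftS (fun k => (k * k.-1)%:R * D s k.-2 2)).
  rewrite -(cvg_shiftS (fun k => (k.+1 * k)%:R * D s k.-1 2)) /=.
  apply: (@le0_cvg _ _ (fun k => 4 * (k./2.+1%:R * D s k./2 1))) => [k|].
    apply/andP; split; first by rewrite mulr_ge0 // (D0 k 2).
    have := @mul_difference_le _ (fun i => D s i 1) k./2 (k - k./2)%N.
    rewrite subnKC => [h|]; last by lia.
    have {}h : (k - k./2)%:R * D s k 2 <= D s k./2 1 - D s k 1.
      by rewrite D1; apply: h => i; rewrite -!D1 -subr_ge0 -D1; exact: D0.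
    have h1 : (k - k./2).+1%:R * D s k 2 <= D s k./2 1.
      rewrite -natr1; have := D1 k 1%N; have := D0 k.+1 1%N; lra.
    have h2 : k.+2%:R <= 2 * (k - k./2).+1%:R :> R by rewrite -natrM ler_nat; lia.
    have h3 : k.+1%:R <= 2 * k./2.+1%:R :> R by rewrite -natrM ler_nat; lia.
    rewrite natrM; apply: (@le_trans _ _ (2 * k.+1%:R * D s k./2 1)).
      have hk : k.+2%:R * D s k 2 <= 2 * D s k./2 1.
        by have := ler_wpM2r (D0 k 2%N) h2; lra.
      by have := ler_wpM2r (ler0n R k.+1) hk; lra.
    by have := ler_wpM2r (D0 k./2 1%N) h3; lra.
  rewrite -[X in _ --> X](mulr0 4); apply: cvgMr.
  exact: (cvg_half b_cvg).
exists g; last split.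
- rewrite (_ : Gseq s = (fun k => D s k 0 - k%:R * D s k.-1 1)).
    by rewrite -[X in _ --> X]subr0; exact: cvgB.
  by apply/funext => k; rewrite GseqE.
- by apply: (cvg_ge a_cvg) => k; exact: D0.
- rewrite (_ : Aseq s = (fun k => (k * k.-1)%:R * D s k.-2 2 -
      2 * (k%:R * D s k.-1 1))).
    have -> : 0 = 0 - 2 * 0 :> R by rewrite mulr0 subr0.
    by apply: cvgB => //; apply: cvgMr.
  by apply/funext => k; rewrite AseqE.
Qed.

(** If g > 0, the restoring force drives the velocity away from 0 logarithmically. If g = 0, the
    energy tends to 0, which antidamping forbids. *)
Lemma not_completely_monotone (s : R) : 6 <= s -> ~ forall k j, 0 <= D s k j.
Proof.
move=> s6 D0; have s0 : 0 < s by lra.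
have [g Gg [g0 A0]] := difference_limits D0.
pose sg := 1 - 6 / s; pose c := 6 / s ^+ 2.
have sg1 : 0 <= sg <= 1.
  rewrite subr_ge0 ler_pdivrMr // mul1r s6 /=.
  by rewrite lerBlDr lerDl divr_ge0 // ltW.
have c0 : 0 < c by rewrite divr_gt0 // exprn_gt0.
have c1 : c <= 1 / 6.
  rewrite /c ler_pdivrMr ?exprn_gt0 //; nra.
have recA k : k.+1%:R * (Aseq s k.+1 - Aseq s k) =
  sg * Aseq s k.+1 - c * Gseq s k.+1 by exact: Aseq_rec.
have := Gseq_rec s; have := Gseq0 s.
have : Aseq s 0 = 0 by rewrite AseqE !mul0r mulr0 subr0.
move: recA Gg A0; move: (Aseq s) (Gseq s) => A G recA Gg A0 A00 G00 recG.
clearbody sg c.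
have GS : (fun k => G k.+1) @ \oo --> g by rewrite (cvg_shiftS G).
have AS : (fun k => A k.+1) @ \oo --> (0 : R) by rewrite (cvg_shiftS A).
have [g_eq0|g_neq0] := eqVneq g 0; last first.
  have cg0 : 0 < c * g / 2 by rewrite divr_gt0 // mulr_gt0 // lt_def g_neq0.
  have : (fun k => sg * A k.+1 - c * G k.+1) @ \oo --> sg * 0 - c * g.
    by apply: cvgB; apply: cvgMr.
  rewrite mulr0 sub0r => /cvgrPdist_lt/(_ _ cg0) [K _ hK].
  apply: (@log_growth _ A _ K cg0 _ A0) => k Kk; rewrite recA.
  have := hK _ Kk; rewrite /= ltr_norml => /andP[h1 h2]; lra.
pose E k := A k ^+ 2 + c * G k ^+ 2.
have E_cvg : E @ \oo --> (0 : R).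
  have -> : 0 = 0 * 0 + c * (0 * 0) :> R by rewrite !mulr0 addr0.
  rewrite g_eq0 in Gg; rewrite /E.
  by apply: cvgD; [exact: cvgM|apply: cvgMr; exact: cvgM].
(* Antidamping has the favourable sign, so energy is lost only in second-order terms of the
   discretization; the constant 3 covers them as [sg <= 1] and [c <= 1 / 6]. *)
have E_step k : E k <= E k.+1 * (1 + 3 / k.+1%:R ^+ 2).
  have k0 : k.+1%:R != 0 :> R by rewrite pnatr_eq0.
  have eA : A k = A k.+1 - (sg * A k.+1 - c * G k.+1) / k.+1%:R.
    by rewrite -recA mulrC mulKf //; ring.
  have eG : G k = G k.+1 - A k.+1 / k.+1%:R.
    by rewrite -recG mulrC mulKf //; ring.
  rewrite /E eA eG; have x0 : 0 < k.+1%:R^-1 :> R by rewrite invr_gt0 ltr0n.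
  rewrite -exprVn; move: (k.+1%:R^-1) (A k.+1) (G k.+1) x0 => x a b x0.
  rewrite -subr_ge0.
  have -> : (a ^+ 2 + c * b ^+ 2) * (1 + 3 * x ^+ 2) -
    ((a - (sg * a - c * b) * x) ^+ 2 + c * (b - a * x) ^+ 2) =
    2 * (sg * a ^+ 2 * x) + x ^+ 2 * (3 * (a ^+ 2 + c * b ^+ 2) -
      (sg * a - c * b) ^+ 2 - c * a ^+ 2) by ring.
  have /andP[sg0 sg1'] := sg1.
  rewrite addr_ge0 //; first by rewrite mulr_ge0 // mulr_ge0 ?(ltW x0) // mulr_ge0 ?sqr_ge0.
  rewrite mulr_ge0 ?sqr_ge0 //.
  have h1 : (sg * a - c * b) ^+ 2 <= 2 * (sg ^+ 2 * a ^+ 2) + 2 * (c ^+ 2 * b ^+ 2).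
    by have := sqr_ge0 (sg * a + c * b); nra.
  have h2 : sg ^+ 2 * a ^+ 2 <= a ^+ 2.
    by rewrite ler_piMl ?sqr_ge0 // expr_le1.
  have h3 : c * (c * b ^+ 2) <= 1 / 6 * (c * b ^+ 2).
    by rewrite ler_wpM2r // mulr_ge0 ?sqr_ge0 // ltW.
  have h4 : c * a ^+ 2 <= 1 / 6 * a ^+ 2 by rewrite ler_wpM2r // sqr_ge0.
  have h5 : 0 <= c * b ^+ 2 by rewrite mulr_ge0 ?sqr_ge0 // ltW.
  have := sqr_ge0 a; lra.
have E1 : 0 < E 1%N.
  have := E_step 0%N; rewrite {1}/E A00 G00 expr1n expr0n /= add0r mulr1.
  by rewrite divr1 => h; lra.
(* Each factor [1 + 3 / n^2] is at most [(n^2 / ((n - 1) (n + 1)))^3], whose product telescopes;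
   hence the energy stays above [E 1 / 8]. *)
have E_low k : E 1%N * k.+2%:R ^+ 3 <= 8 * (E k.+1 * k.+1%:R ^+ 3).
  elim: k => [|k IH]; first by rewrite expr1n mulr1; lra.
  have := E_step k.+1; have : 0 <= E k.+2.
    by rewrite addr_ge0 ?sqr_ge0 // mulr_ge0 ?sqr_ge0 // ltW.
  move: IH; have : 0 < k.+1%:R :> R by rewrite ltr0n.
  rewrite -[k.+3%:R]natr1 -[k.+2%:R]natr1.
  move: (k.+1%:R) (E k.+1) (E k.+2) (E 1%N) E1 => x e f e1 e10 x0 IH f0 h.
  have n0 : 0 < x + 1 by lra.
  have {}h : e * (x + 1) ^+ 2 <= f * ((x + 1) ^+ 2 + 3).
    have := ler_wpM2r (sqr_ge0 (x + 1)) h; rewrite -mulrA mulrDl mul1r divfK //.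
    by rewrite expf_neq0 // gt_eqF.
  have h1 : e1 * (x + 1) ^+ 5 <= 8 * f * (((x + 1) ^+ 2 + 3) * x ^+ 3).
    have := ler_wpM2r (sqr_ge0 (x + 1)) IH.
    have := ler_wpM2r (exprn_ge0 3 (ltW x0)) h; lra.
  rewrite -(@ler_pM2r _ ((x + 1) ^+ 5)) ?exprn_gt0 //.
  have := ler_wpM2r (exprn_ge0 3 (ltW (addr_gt0 n0 ltr01))) h1.
  have h2 : ((x + 1) ^+ 2 + 3) * x ^+ 3 * (x + 1 + 1) ^+ 3 <= (x + 1) ^+ 8.
    rewrite -subr_ge0 (_ : _ - _ =
      6 * (x + 1) ^+ 4 - 8 * (x + 1) ^+ 2 + 3); last by ring.
    have := sqr_ge0 ((x + 1) ^+ 2 - 1); have := sqr_ge0 ((x + 1) ^+ 2); nra.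
  have := ler_wpM2l f0 h2; lra.
have : 8 * 0 >= E 1%N.
  have h : (fun k => 8 * E k.+1) @ \oo --> (8 * 0 : R).
    by apply: cvgMr; rewrite (cvg_shiftS E).
  apply: (cvg_ge h) => k; have := E_low k.
  have x0 : 0 < k.+1%:R :> R by rewrite ltr0n.
  have y3 : k.+1%:R ^+ 3 <= k.+2%:R ^+ 3 :> R.
    by rewrite lerXn2r ?nnegrE ?ler0n // ler_nat.
  move=> low; rewrite -(ler_pM2r (exprn_gt0 3 x0)).
  by have := ler_wpM2l (ltW E1) y3; lra.
by rewrite mulr0 leNgt E1.
Qed.

End NotCompletelyMonotone.

(** * The kernel *)

Section Tail.
Variable F : fieldType.
Variable a : nat -> F.
Hypothesis a_cubic : forall n,
  a n.+4 = 4 * a n.+3 - 6 * a n.+2 + 4 * a n.+1 - a n.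

(* The sum of the series \sum_m a (n + m) x^m, in closed form: multiply it by
   (1 - x)^4 and use that the fourth differences of [a] vanish. *)
Definition tail n (x : F) : F :=
  (a n * (1 - 4 * x + 6 * x ^+ 2 - 4 * x ^+ 3)
   + a n.+1 * (x * (1 - 4 * x + 6 * x ^+ 2))
   + a n.+2 * (x ^+ 2 * (1 - 4 * x)) + a n.+3 * x ^+ 3) / (1 - x) ^+ 4.

Lemma tailS n x : x != 1 -> x * tail n.+1 x = tail n x - a n.
Proof.
move=> x1; rewrite /tail a_cubic; field.
by rewrite subr_eq0 eq_sym.
Qed.

Lemma tail_sum n x : x != 1 ->
  tail 0 x - \sum_(m < n) a m * x ^+ m = x ^+ n * tail n x.
Proof.
move=> x1; elim: n => [|n IH]; first by rewrite big_ord0 subr0 mul1r.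
by rewrite big_ord_recr /= opprD addrA IH exprSr -mulrA tailS //; ring.
Qed.

End Tail.

Lemma tail_rmorph (F K : fieldType) (f : {rmorphism F -> K}) (a : nat -> F) n x :
  f (tail a n x) = tail (f \o a) n (f x).
Proof.
by rewrite /tail fmorph_div /=
  !(rmorph1, rmorph_nat, rmorphXn, rmorphB, rmorphD, rmorphM).
Qed.

Lemma cubic_rmorph (F K : fieldType) (f : {rmorphism F -> K}) (a : nat -> F) n :
  a n.+4 = 4 * a n.+3 - 6 * a n.+2 + 4 * a n.+1 - a n ->
  f (a n.+4) = 4 * f (a n.+3) - 6 * f (a n.+2) + 4 * f (a n.+1) - f (a n).
Proof. by move=> ->; rewrite !(rmorph_nat, rmorphB, rmorphD, rmorphM). Qed.

Section KernelCoefficients.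
Variable R : realType.
Variable s : R.

Lemma kcoef_cubic n : kcoef s n.+4 =
  4 * kcoef s n.+3 - 6 * kcoef s n.+2 + 4 * kcoef s n.+1 - kcoef s n.
Proof. by rewrite /kcoef -!natr1; field. Qed.

Definition kcoefC n : R[i] := (kcoef s n)%:C.

Lemma kcoefC_cubic n : kcoefC n.+4 =
  4 * kcoefC n.+3 - 6 * kcoefC n.+2 + 4 * kcoefC n.+1 - kcoefC n.
Proof. exact: (@cubic_rmorph _ _ (real_complex R)) (kcoef_cubic n). Qed.

Lemma tail_real n (x : R) : tail kcoefC n x%:C = (tail (kcoef s) n x)%:C.
Proof.
by rewrite -[RHS]/(real_complex R _) tail_rmorph.
Qed.

(** Both sides are rational in x with denominator [(1 - x)^4], so the first four coefficients settle
    the identity. *)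
Lemma bergman_tail (z w : R[i]) : z * Num.conj w != 1 ->
  bergman_kernel s z w * bergman_kernel s z w = tail kcoefC 0 (z * Num.conj w).
Proof.
rewrite /bergman_kernel; move: (_ * _) => x x1.
have k0 : kcoefC 0 = 1 by rewrite /kcoefC kcoef0.
have k1 : kcoefC 1 = 2 + 2 * s%:C.
  rewrite /kcoefC (_ : kcoef s 1 = 2 + 2 * s); last by rewrite /kcoef; field.
  by rewrite !(rmorph_nat, rmorphD, rmorphM).
have k2 : kcoefC 2 = 3 + 6 * s%:C + s%:C ^+ 2.
  rewrite /kcoefC (_ : kcoef s 2 = 3 + 6 * s + s ^+ 2); last by rewrite /kcoef; field.
  by rewrite !(rmorph_nat, rmorphXn, rmorphD, rmorphM).
have k3 : kcoefC 3 = 4 + 12 * s%:C + 4 * s%:C ^+ 2.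
  rewrite /kcoefC (_ : kcoef s 3 = 4 + 12 * s + 4 * s ^+ 2); last by rewrite /kcoef; field.
  by rewrite !(rmorph_nat, rmorphXn, rmorphD, rmorphM).
rewrite /tail k0 k1 k2 k3 rmorphB rmorph1; field.
by rewrite subr_eq0 eq_sym.
Qed.

Lemma tail_bounded n : exists B : R, forall x : R[i], nrm x <= 1 / 2 ->
  nrm (tail kcoefC n x) <= B.
Proof.
exists (256 * (nrm (kcoefC n) + nrm (kcoefC n.+1) + nrm (kcoefC n.+2)
  + nrm (kcoefC n.+3))) => x x2.
have nn (m : nat) : nrm (m%:R : R[i]) = m%:R.
  by have := nrm_real (m%:R : R); rewrite rmorph_nat normr_nat.
have n1 : nrm (1 : R[i]) = 1 by exact: (nn 1%N).
have x0 := nrm_ge0 x.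
have x_2 : nrm x ^+ 2 <= 1 / 4 by nra.
have x_3 : nrm x ^+ 3 <= 1 / 8 by rewrite exprS; have := sqr_ge0 (nrm x); nra.
have b1 : nrm (1 - 4 * x) <= 3.
  apply: le_trans (nrmD _ _) _; rewrite nrmN nrmM n1 !nn; lra.
have b2 : nrm (1 - 4 * x + 6 * x ^+ 2) <= 5.
  apply: le_trans (nrmD _ _) _; rewrite nrmM nrmX !nn; lra.
have b3 : nrm (1 - 4 * x + 6 * x ^+ 2 - 4 * x ^+ 3) <= 6.
  apply: le_trans (nrmD _ _) _; rewrite nrmN nrmM nrmX !nn; lra.
have d1 : 1 / 2 <= nrm (1 - x).
  have := nrmD (1 - x) x; rewrite subrK n1; lra.
have d4 : (nrm (1 - x) ^+ 4)^-1 <= 16.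
  have d0 : 0 < nrm (1 - x) by lra.
  have h4 : (1 / 2) ^+ 4 <= nrm (1 - x) ^+ 4.
    by rewrite lerXn2r // nnegrE; lra.
  rewrite -[leRHS]invrK lef_pV2 ?posrE ?exprn_gt0 ?invr_gt0 //.
  by apply: le_trans h4; lra.
rewrite /tail nrmM nrmV nrmX.
set c0 := kcoefC n; set c1 := kcoefC _; set c2 := kcoefC _; set c3 := kcoefC _.
have := nrm_ge0 c0; have := nrm_ge0 c1; have := nrm_ge0 c2; have := nrm_ge0 c3.
move=> h3 h2 h1 h0.
apply: (@le_trans _ _ ((nrm c0 * 6 + nrm c1 * 5 + nrm c2 * 3 + nrm c3) * 16)).
  apply: ler_pM => //; rewrite ?invr_ge0 ?exprn_ge0 ?nrm_ge0 //.
  have T (u v w z : R[i]) : nrm (u + v + w + z) <= nrm u + nrm v + nrm w + nrm z.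
    have := nrmD (u + v + w) z; have := nrmD (u + v) w; have := nrmD u v; lra.
  apply: le_trans (T _ _ _ _) _.
  apply: lerD; [apply: lerD; [apply: lerD|]|]; rewrite !nrmM ?nrmX.
  - by rewrite ler_wpM2l.
  - rewrite ler_wpM2l //; have := nrm_ge0 (1 - 4 * x + 6 * x ^+ 2); nra.
  - rewrite ler_wpM2l //; have := nrm_ge0 (1 - 4 * x); nra.
  - by rewrite ler_piMr //; lra.
by lra.
Qed.

End KernelCoefficients.

(** * Monomials *)

Section Monomials.
Variable R : realType.
Variables (s : R) (H : holomorphicSpace R).
Hypothesis s0 : 0 < s.
Variable k : R[i] -> H.
Hypothesis k_eval : forall w z, unit_disc w -> unit_disc z ->
  Defs.eval (k w) z = tail (kcoefC s) 0 (z * Num.conj w).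
Hypothesis k_rep : forall w f, unit_disc w -> Defs.eval f w = inner H f (k w).

Local Notation a := (kcoefC s).
Local Notation ip := (inner H).

Lemma discP (z : R[i]) : unit_disc z <-> nrm z < 1.
Proof. by rewrite /unit_disc /mkset nrmE -ltcR. Qed.

Lemma a_neq0 n : a n != 0.
Proof. by rewrite /kcoefC (inj_eq (@complexI R)) kcoef_neq0. Qed.

Lemma disc_mul (z w : R[i]) : unit_disc z -> unit_disc w -> z * Num.conj w != 1.
Proof.
move=> /discP zd /discP wd; apply/eqP => /(congr1 (@nrm _ _)).
rewrite nrmM nrm_conj (_ : nrm 1 = 1); last first.
  by have := nrm_real (1 : R); rewrite rmorph1 normr1.
have := nrm_ge0 z; have := nrm_ge0 w; nra.
Qed.

(** The space is given only by its kernel, so that it contains z^i has to be shown; n counts the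
    monomials already found. *)
Definition monomials (zeta : nat -> H) n : Prop :=
  (forall i z, (i < n)%N -> unit_disc z -> Defs.eval (zeta i) z = z ^+ i) /\
  (forall i j, (i < n)%N -> (j < n)%N ->
     ip (zeta i) (zeta j) = (a i)^-1 *+ (i == j)).

(** The kernel function at w minus its projection on the monomials found so far. *)
Definition remainder (zeta : nat -> H) n w : H :=
  k w - \sum_(m < n) (a m * Num.conj w ^+ m) *: zeta m.

Lemma remainder_orth zeta n w m : monomials zeta n -> unit_disc w -> (m < n)%N ->
  ip (remainder zeta n w) (zeta m) = 0.
Proof.
move=> [Ze Zo] wd mn; rewrite ipBl ip_suml (ipC _ (k w)) -k_rep // Ze //.
rewrite (bigD1 (Ordinal mn)) //= ipZl Zo // eqxx mulr1n big1 => [|i im].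
  by rewrite addr0 mulrAC divff ?a_neq0 // mul1r rmorphXn subrr.
rewrite ipZl Zo // (_ : (i == m :> nat) = false) ?mulr0 //.
by apply/negbTE; apply: contra im => /eqP im; apply/eqP/val_inj.
Qed.

Lemma remainder_k zeta n w z : monomials zeta n -> unit_disc w -> unit_disc z ->
  ip (remainder zeta n w) (k z) =
  (z * Num.conj w) ^+ n * tail a n (z * Num.conj w).
Proof.
move=> [Ze Zo] wd zd; rewrite ipBl ip_suml -k_rep // k_eval //.
rewrite -(tail_sum (kcoefC_cubic s) _ (disc_mul zd wd)); congr (_ - _).
apply: eq_bigr => m _; rewrite ipZl -k_rep // Ze // exprMn.
by rewrite -mulrA [_ ^+ m * _]mulrC.
Qed.

Lemma remainder_ip zeta n w v : monomials zeta n -> unit_disc w -> unit_disc v ->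
  ip (remainder zeta n w) (remainder zeta n v) =
  (v * Num.conj w) ^+ n * tail a n (v * Num.conj w).
Proof.
move=> Z wd vd; rewrite {2}/remainder ipBr remainder_k // ip_sumr big1 ?subr0 //.
by move=> m _; rewrite ipZr remainder_orth ?mulr0.
Qed.

Lemma tail_near n : exists2 B : R, 0 <= B & forall x : R[i], nrm x <= 1 / 2 ->
  nrm (tail a n x - a n) <= B * nrm x.
Proof.
have [B hB] := tail_bounded s n.+1; exists B => [|x x2].
  by apply: le_trans (hB 0 _); rewrite ?nrm_ge0 // nrm0; lra.
have x1 : x != 1.
  apply/eqP => x1; move: x2; rewrite x1.
  by have := nrm_real (1 : R); rewrite rmorph1 normr1 => ->; lra.
rewrite -(tailS (kcoefC_cubic s) _ x1) nrmM mulrC.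
by apply: ler_wpM2r; [exact: nrm_ge0|exact: hB].
Qed.

Lemma inv_nat_cvg (c : R) : (fun j : nat => c / j.+2%:R) @ \oo --> (0 : R).
Proof.
rewrite -[X in _ --> X](mulr0 c); apply: cvgMr.
by rewrite (cvg_shiftS (fun j => j.+1%:R^-1 : R)); exact: cvg_harmonic.
Qed.

Lemma nrm_sub_sqr (x y : H) :
  nrm (x - y) ^+ 2 = nrm (ip x x - ip y x - (ip x y - ip y y)).
Proof.
by rewrite -!ipBl -ipBr ip_sqr nrm_real ger0_norm ?sqr_ge0.
Qed.

(** Up to the factor [a n], z^n is the leading coefficient of the remainder in the conjugate of w.
    It is obtained as the norm limit of the rescaled remainders at the real points [r j], which tend
    to 0. *)
Lemma monomials_step zeta n : monomials zeta n ->
  exists l, monomials (fun i => if i == n then l else zeta i) n.+1.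
Proof.
move=> Z; have [Ze Zo] := Z; have [B B0 hB] := tail_near n.
have [r rE] : exists r : nat -> R[i], forall j, r j = (j.+2%:R^-1 : R)%:C.
  by exists (fun j => (j.+2%:R^-1 : R)%:C).
have nr j : nrm (r j) = j.+2%:R^-1.
  by rewrite rE nrm_real ger0_norm // invr_ge0.
have r2 j : nrm (r j) <= 1 / 2.
  by rewrite nr div1r lef_pV2 ?posrE ?ltr0n // ler_nat.
have rd j : unit_disc (r j) by apply/discP; have := r2 j; lra.
have rc j : Num.conj (r j) = r j by rewrite rE conj_Creal // complex_real.
have r0 j : r j != 0.
  by rewrite rE (inj_eq (@complexI R)) invr_eq0 pnatr_eq0.
have [g gE] : exists g, forall j, g j = (a n * r j ^+ n)^-1 *: remainder zeta n (r j).
  by exists (fun j => (a n * r j ^+ n)^-1 *: remainder zeta n (r j)).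
have an0 := a_neq0 n.
have gg i j : ip (g i) (g j) = tail a n (r j * r i) / a n ^+ 2.
  rewrite !gE ipZl ipZr remainder_ip // rc.
  have -> : Num.conj (a n * r j ^+ n)^-1 = (a n * r j ^+ n)^-1.
    apply: conj_Creal; rewrite rpredV; apply: rpredM; last apply: rpredX.
      by rewrite /kcoefC complex_real.
    by rewrite rE complex_real.
  have ri := expf_neq0 n (r0 i); have rj := expf_neq0 n (r0 j).
  by rewrite exprMn; move: ri rj; set u := r i ^+ n; set v := r j ^+ n => u0 v0; field; rewrite an0 u0 v0.
have [A AE] : exists A, A = nrm (a n) by eexists.
have A0 : 0 < A.
  by rewrite AE lt_def nrm_ge0 andbT; apply: contra_neq an0 => /nrm0_eq0.
(* Up to the factor [1 / a n ^+ 2], all four Gram entries are within [B / (N + 2)] of [a n], and the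
   four copies of [a n] cancel. *)
have gN i j N : (N <= i)%N -> (N <= j)%N ->
    nrm (g i - g j) ^+ 2 <= (4 * B / A ^+ 2) / N.+2%:R.
  move=> Ni Nj.
  have sm i' j' : (N <= i')%N -> (N <= j')%N ->
      nrm (tail a n (r j' * r i') - a n) <= B / N.+2%:R.
    move=> Ni' Nj'; have hn m : (N <= m)%N -> nrm (r m) <= N.+2%:R^-1.
      by move=> Nm; rewrite nr lef_pV2 ?posrE ?ltr0n // ler_nat.
    have h : nrm (r j' * r i') <= N.+2%:R^-1.
      apply: le_trans (hn _ Ni'); rewrite nrmM ler_piMl ?nrm_ge0 //.
      by have := r2 j'; lra.
    apply: le_trans (hB _ _) _; last by rewrite ler_wpM2l.
    apply: le_trans (r2 i'); rewrite nrmM ler_piMl ?nrm_ge0 //.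
    by have := r2 j'; lra.
  rewrite nrm_sub_sqr !gg.
  move: (sm i i Ni Ni) (sm i j Ni Nj) (sm j i Nj Ni) (sm j j Nj Nj).
  move: (tail _ _ (r i * r i)) (tail _ _ (r j * r i)) (tail _ _ (r i * r j)).
  move: (tail _ _ (r j * r j)) => t4 t1 t3 t2 S1 S3 S2 S4.
  have -> : t1 / a n ^+ 2 - t2 / a n ^+ 2 - (t3 / a n ^+ 2 - t4 / a n ^+ 2) =
    ((t1 - a n) - (t2 - a n) - (t3 - a n) + (t4 - a n)) / a n ^+ 2 by ring.
  rewrite nrmM nrmV nrmX -AE [leRHS]mulrAC; apply: ler_pM => //.
  - exact: nrm_ge0.
  - by rewrite invr_ge0 sqr_ge0.
  have T (u v w z : R[i]) : nrm (u - v - w + z) <= nrm u + nrm v + nrm w + nrm z.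
    have := nrmD (u - v - w) z; have := nrmD (u - v) (- w); have := nrmD u (- v).
    rewrite !nrmN; lra.
  apply: le_trans (T _ _ _ _) _.
  have -> : 4 * B / N.+2%:R = B / N.+2%:R + B / N.+2%:R + B / N.+2%:R + B / N.+2%:R.
    by ring.
  by rewrite lerD // lerD // lerD.
have [l hl] : exists l, hcvg g l.
  apply: hilbert_complete => e e0; have e2 : 0 < e ^+ 2 by rewrite exprn_gt0.
  have /cvgrPdist_lt/(_ _ e2) [N _ hN] := inv_nat_cvg (4 * B / A ^+ 2).
  exists N => i j Ni Nj; rewrite -(@ltr_pXn2r _ 2) ?nnegrE ?nrm_ge0 ?ltW //.
  apply: le_lt_trans (gN i j N Ni Nj) _.
  have := hN N (leqnn _); rewrite /= sub0r normrN.
  by apply: le_lt_trans; exact: ler_norm.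
have lz z : unit_disc z -> Defs.eval l z = z ^+ n.
  move=> zd; rewrite k_rep //; apply: hcvg_unique (hcvg_ipl (k z) hl) _.
  apply: (@hcvg_le _ _ _ _ (fun j => nrm z ^+ n / A * B / j.+2%:R)) => [j|]; last first.
    exact: inv_nat_cvg.
  have -> : ip (g j) (k z) - z ^+ n = z ^+ n / a n * (tail a n (z * r j) - a n).
    rewrite gE ipZl remainder_k // rc exprMn; field.
    by rewrite an0 expf_neq0.
  rewrite 2!nrmM nrmV nrmX -AE -[leRHS]mulrA ler_wpM2l //.
    by rewrite divr_ge0 ?exprn_ge0 ?nrm_ge0 // ltW.
  have zr : nrm (z * r j) <= j.+2%:R^-1.
    rewrite nrmM nr ler_piMl ?invr_ge0 //.
    by have /discP := zd; lra.
  apply: le_trans (hB _ _) _; last by rewrite ler_wpM2l.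
  by apply: le_trans zr _; rewrite -nr.
have lo m : (m < n)%N -> ip l (zeta m) = 0.
  move=> mn; apply: hcvg_unique (hcvg_ipl (zeta m) hl) _.
  apply: (@hcvg_near _ _ _ _ 0%N) => j _.
  by rewrite gE ipZl remainder_orth ?mulr0.
(* The reproducing property gives [<g j, l>] from the value of l at [r j], which is already
   known. *)
have ll : ip l l = (a n)^-1.
  apply: hcvg_unique (hcvg_ipl l hl) _; apply: (@hcvg_near _ _ _ _ 0%N) => j _.
  rewrite gE ipZl ipBl ip_suml big1 => [|m _]; last first.
    by rewrite ipZl ipC lo // rmorph0 mulr0.
  rewrite subr0 ipC -k_rep // lz // rmorphXn /= rc; field.
  by rewrite an0 expf_neq0.
exists l; split=> [i z|i j].
  by rewrite ltnS leq_eqVlt; case: eqVneq => [-> _ /lz|_ /Ze h /h].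
rewrite !ltnS (leq_eqVlt i) (leq_eqVlt j).
case: (eqVneq i n) => [-> _|ni /= iN]; case: (eqVneq j n) => [-> _|nj /= jN].
- by [].
- by rewrite lo // eq_sym (negPf nj).
- by rewrite ipC lo // rmorph0 (negPf ni).
- exact: Zo.
Qed.

(** The systems for different n are chosen separately; they agree because an element is determined
    by its values on the disc. *)
Lemma monomials_exist : exists zeta : nat -> H, forall n, monomials zeta n.
Proof.
have fin n : exists zeta, monomials zeta n.
  elim: n => [|n [zeta Z]]; first by exists (fun=> 0); split.
  by have [l Zl] := monomials_step Z; eexists; exact: Zl.
pose zeta n := projT1 (cid (fin n.+1)) n.
have zE n z : unit_disc z -> Defs.eval (zeta n) z = z ^+ n.
  by move=> zd; have [h _] := projT2 (cid (fin n.+1)); apply: h.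
exists zeta => n; split=> [i z _|i j iN jN]; first exact: zE.
have [z [ze zo]] := fin n.
have E m : (m < n)%N -> zeta m = z m.
  by move=> mn; apply: Defs.eval_inj => w wd; rewrite zE // ze.
by rewrite !E // zo.
Qed.

(** Such an f satisfies [f(w) = <f, remainder>] for every n, so it suffices that the remainders tend
    to 0 in norm. *)
Lemma monomials_complete zeta f : (forall n, monomials zeta n) ->
  (forall n, ip f (zeta n) = 0) -> f = 0.
Proof.
move=> Z f0; apply: Defs.eval_inj => w wd.
rewrite !k_rep // ip0l; apply: nrm0_eq0; apply/eqP; rewrite eq_le nrm_ge0 andbT.
pose x := nrm w ^+ 2; pose T n := nrm (remainder zeta n w) ^+ 2.
have wx : w * Num.conj w = x%:C by rewrite nrm_sqr.
have x1 : x != 1 by have := disc_mul wd wd; rewrite wx (inj_eq (@complexI R)).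
have TE n : T n = x ^+ n * tail (kcoef s) n x.
  apply: (@complexI R); rewrite -ip_sqr remainder_ip // wx tail_real.
  by rewrite -rmorphXn -rmorphM.
have T0 n : 0 <= T n by rewrite sqr_ge0.
pose u n := kcoef s n * x ^+ n.
have Tu n : u n = T n - T n.+1.
  rewrite !TE exprSr -mulrA tailS //; first by rewrite /u; ring.
  exact: kcoef_cubic.
have u0 n : 0 <= u n.
  apply: mulr_ge0; first by apply/ltW/kcoef_gt0.
  by rewrite exprn_ge0 // sqr_ge0.
have T_cvg : cvgn T.
  apply: nonincreasing_is_cvgn; last by exists 0 => _ [n _ <-].
  by apply/nonincreasing_seqP => n; rewrite -subr_ge0 -Tu.
have u_cvg : u @ \oo --> (0 : R).
  rewrite (_ : u = (fun n => T n - T n.+1)); last exact/funext.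
  rewrite -(subrr (lim (T @ \oo))); apply: cvgB => //.
  by rewrite (cvg_shiftS T).
have uS m : (fun n => u (n + m)%N) @ \oo --> (0 : R) by rewrite cvg_shiftn.
(* The closed form makes [T n] a fixed combination of four consecutive [u], and [u] tends to 0 as
   the decrement of the convergent sequence T. *)
have T_0 : T @ \oo --> (0 : R).
  rewrite (_ : T = (fun n => (u (n + 0)%N * (1 - 4 * x + 6 * x ^+ 2 - 4 * x ^+ 3)
   + u (n + 1)%N * (1 - 4 * x + 6 * x ^+ 2)
   + u (n + 2)%N * (1 - 4 * x) + u (n + 3)%N) / (1 - x) ^+ 4)); last first.
    apply/funext => n; rewrite TE /tail /u !addnS addn0 [LHS]mulrA; congr (_ / _).
    by rewrite !exprS; ring.
  have -> : 0 = (0 * (1 - 4 * x + 6 * x ^+ 2 - 4 * x ^+ 3)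
   + 0 * (1 - 4 * x + 6 * x ^+ 2) + 0 * (1 - 4 * x) + 0) / (1 - x) ^+ 4 by ring.
  apply: cvgMl; do 2! [apply: cvgD => //]; try by apply: cvgMl.
  by apply: cvgD; apply: cvgMl.
have fr n : nrm (ip f (k w)) ^+ 2 <= nrm f ^+ 2 * T n.
  rewrite -exprMn lerXn2r ?nnegrE ?mulr_ge0 ?nrm_ge0 //.
  apply: le_trans (cauchy_schwarz _ _); rewrite ipBr ip_sumr big1 ?subr0 //.
  by move=> m _; rewrite ipZr f0 mulr0.
have h : (fun n => nrm f ^+ 2 * T n) @ \oo --> (nrm f ^+ 2 * 0 : R) by exact: cvgMr.
have := cvg_ge h fr; rewrite mulr0 => h'.
by rewrite -(@ler_pXn2r _ 2) ?nnegrE ?nrm_ge0 // expr0n.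
Qed.

End Monomials.

(** * The weighted shift *)

Section WeightedShift.
Variable R : realType.
Variables (s : R) (H : holomorphicSpace R).
Hypothesis s0 : 0 < s.
Variables (k : R[i] -> H) (zeta : nat -> H).
Hypothesis k_rep : forall w f, unit_disc w -> Defs.eval f w = inner H f (k w).
Hypothesis zeta_mono : forall n, monomials s zeta n.
Hypothesis zeta_complete : forall f, (forall n, inner H f (zeta n) = 0) -> f = 0.

Local Notation ip := (inner H).
Local Notation a := (kcoef s).

Lemma zeta_eval n z : unit_disc z -> Defs.eval (zeta n) z = z ^+ n.
Proof. by move=> zd; have [h _] := zeta_mono n.+1; apply: h. Qed.

Lemma zeta_ip i j : ip (zeta i) (zeta j) = (kcoefC s i)^-1 *+ (i == j).
Proof.
by have [_ h] := zeta_mono (maxn i j).+1; apply: h; rewrite ltnS ?leq_maxl ?leq_maxr.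
Qed.

Definition unit_monomial n : H := (Num.sqrt (a n))%:C *: zeta n.
Local Notation e := unit_monomial.

Lemma sqrt_neq0 n : Num.sqrt (a n) != 0.
Proof. by rewrite gt_eqF // sqrtr_gt0 kcoef_gt0. Qed.

Lemma unit_monomial_on i j : ip (e i) (e j) = (i == j)%:R.
Proof.
rewrite ipZl ipZr zeta_ip conj_Creal ?complex_real //.
case: eqVneq => [<-|_]; last by rewrite !mulr0n !mulr0.
rewrite mulr1n mulrA -rmorphM -expr2 sqr_sqrtr ?ltW ?kcoef_gt0 //.
by rewrite /kcoefC divff // (inj_eq (@complexI R)) kcoef_neq0.
Qed.

Lemma unit_monomial_complete f : (forall i, ip f (e i) = 0) -> f = 0.
Proof.
move=> fe; apply: zeta_complete => n; have := fe n.
rewrite ipZr conj_Creal ?complex_real // => /eqP; rewrite mulf_eq0.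
by rewrite (inj_eq (@complexI R)) (negPf (sqrt_neq0 n)) => /eqP.
Qed.

(** A weighted shift on the orthonormal monomials, contractive because [kcoef] increases; continuity
    of point evaluation identifies it with multiplication by z. *)
Lemma coordinate_multiplication : exists M : {linear H -> H},
  is_coordinate_multiplication M.
Proof.
pose w n := Num.sqrt (a n) / Num.sqrt (a n.+1).
have w01 n : 0 <= w n <= 1.
  rewrite divr_ge0 ?sqrtr_ge0 //= ler_pdivrMr ?sqrtr_gt0 ?kcoef_gt0 // mul1r.
  by apply: ler_wsqrtr; exact: kcoef_mono.
have [] := @synthesis _ _ _ unit_monomial_on (fun n => (w n)%:C *: e n.+1).
- move=> i j ij; rewrite ipZl ipZr unit_monomial_on eqSS.
  by case: eqP => // _; rewrite !mulr0.
- move=> i; have /andP[w0 w1] := w01 i.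
  by rewrite nrmZ nrm_real ger0_norm // (onb_norm unit_monomial_on) mulr1.
move=> M [Mb Me Mc]; exists M; split.
  by apply/bndP; exists 1 => f; rewrite mul1r.
move=> f z zd; rewrite !k_rep //.
apply: hcvg_unique (hcvg_ipl (k z) (Mc f)) _.
have h := hcvg_ipl (k z) (fourier_cvg unit_monomial_on unit_monomial_complete f).
have := @hcvg_lip _ _ _ (fun u : R[i] => z * u) (nrm z) _ _ _ h.
rewrite (_ : (fun n => z * _) = (fun n =>
  ip (\sum_(0 <= j < n) ip f (e j) *: ((w j)%:C *: e j.+1)) (k z))).
  by apply=> u v; rewrite -mulrBr nrmM.
apply/funext => n; rewrite !ip_suml mulr_sumr; apply: eq_bigr => j _.
rewrite !ipZl mulrCA; congr (_ * _).
rewrite -!k_rep // !zeta_eval // exprS mulrCA [RHS]mulrA -rmorphM /w.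
by rewrite divfK ?sqrt_neq0 // mulrCA.
Qed.

Lemma shift_monomial (M : {linear H -> H}) n :
  is_coordinate_multiplication M -> M (zeta n) = zeta n.+1.
Proof.
by move=> [_ Mz]; apply: Defs.eval_inj => z zd; rewrite Mz // !zeta_eval // exprS.
Qed.

(** The vectors [iter n N xi] of the dilation have the Gram matrix of the monomials, so sending z^n
    to [iter n N xi] extends to an isometry V that intertwines M and N. *)
Lemma subnormal_of_le2 : s <= 2 -> subnormal_hilbert_module H.
Proof.
move=> s2; have [M Mc] := coordinate_multiplication.
have s02 : 0 < s <= 2 by rewrite s0.
pose l : {scalar {poly R}} := even_moment s.
have l_pos (q : {poly R}) : 0 <= l (q ^+ 2).
  by apply: even_moment_ge0 => // x _; rewrite horner_exp sqr_ge0.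
have l_contr (q : {poly R}) : l (('X * q) ^+ 2) <= l (q ^+ 2).
  rewrite -subr_ge0 -linearB; apply: even_moment_ge0 => // x /andP[x1 x2].
  rewrite !hornerE /= exprMn -[X in X - _]mul1r -mulrBl mulr_ge0 ?sqr_ge0 //.
  by rewrite subr_ge0; nra.
have [N [xi [nN Nxi]]] := normal_dilation unit_monomial_on unit_monomial_complete
  l_pos l_contr (@even_moment_odd _ s).
have Nxi' i j : ip (iter i N xi) (iter j N xi) = (kcoefC s i)^-1 *+ (i == j).
  rewrite Nxi; case: eqVneq => [<-|_]; last by rewrite !mulr0n.
  by rewrite !mulr1n addnn /l /= even_momentX2n fmorphV.
pose g n := (Num.sqrt (a n))%:C *: iter n N xi.
have gg i j : ip (g i) (g j) = (i == j)%:R.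
  by rewrite ipZl ipZr Nxi' -zeta_ip -ipZr -ipZl unit_monomial_on.
have [] := @synthesis _ _ _ unit_monomial_on g.
- by move=> i j ij; rewrite gg; case: eqP.
- by move=> i; rewrite (onb_norm gg).
move=> V [Vb Ve _].
have bV : bnd V by exists 1 => f; rewrite mul1r.
have bid : bnd (@idfun H) by exists 1 => x; rewrite mul1r.
exists M; split=> //; split; first by case: Mc.
exists H, V, N; split=> //.
- apply: (@form_ext _ _ _ unit_monomial_on unit_monomial_complete _ _ V V idfun idfun) => //.
  by move=> i j /=; rewrite !Ve gg unit_monomial_on.
- have bM : bnd M by apply/bndP; case: Mc.
  have bN : bnd N by apply/bndP; case: nN.
  apply: (op_ext unit_monomial_on unit_monomial_complete
    (bnd_comp bN bV) (bnd_comp bV bM)).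
  move=> n /=; rewrite Ve /g /unit_monomial !linearZZ (shift_monomial n Mc).
  congr (_ *: _); have -> : zeta n.+1 = (Num.sqrt (a n.+1))^-1%:C *: e n.+1.
    by rewrite scalerA -rmorphM mulVf ?sqrt_neq0 // scale1r.
  by rewrite linearZZ Ve /g scalerA -rmorphM mulVf ?sqrt_neq0 // scale1r.
Qed.

(** A normal extension moves the image of 1 through the images of z^n, whose squared norms
    [1 / kcoef s n] are at most 1; their differences would all be nonnegative. *)
Lemma not_subnormal_of_ge6 : 6 <= s -> ~ subnormal_hilbert_module H.
Proof.
move=> s6 [M [Mc [_ [K [V [N [Viso nN NV]]]]]]].
apply: (not_completely_monotone s6).
have NV0 n : iter n N (V (zeta 0)) = V (zeta n).
  by elim: n => //= n ->; rewrite NV (shift_monomial n Mc).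
apply: (normal_difference_ge0 nN (f := V (zeta 0))) => [n|].
  by rewrite NV0 Viso zeta_ip eqxx mulr1n fmorphV.
exists 1 => n; rewrite invf_le1 ?kcoef_gt0 //; exact: kcoef_ge1.
Qed.

End WeightedShift.

Theorem corollary1p8 (R : realType) (s : R) (hs : 0 < s)
    (H : holomorphicSpace R)
    (hH : is_module_tensor_product (bergman_kernel s) (bergman_kernel s) H) :
  (s <= 2 -> subnormal_hilbert_module H) /\
  (6 <= s -> hilbert_module H /\ ~ subnormal_hilbert_module H).
Proof.
(* Kernel functions exist only for w in the disc; the default 0 elsewhere allows a total choice
   function. *)
have kex w : exists kw : H, unit_disc w ->
    (forall z, unit_disc z -> Defs.eval kw z =
      bergman_kernel s z w * bergman_kernel s z w) /\
    (forall f : H, Defs.eval f w = inner H f kw).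
  have [wd|wd] := pselect (unit_disc w); last by exists 0.
  by have [kw hkw] := hH w wd; exists kw.
pose k w := projT1 (cid (kex w)).
have kP w : unit_disc w -> _ := projT2 (cid (kex w)).
have k_rep w f : unit_disc w -> Defs.eval f w = inner H f (k w).
  by move=> wd; have [_ h] := kP w wd; apply: h.
have k_eval w z : unit_disc w -> unit_disc z ->
    Defs.eval (k w) z = tail (kcoefC s) 0 (z * Num.conj w).
  move=> wd zd; rewrite -bergman_tail; last exact: disc_mul.
  by have [h _] := kP w wd; apply: h.
have [zeta Z] := monomials_exist hs k_eval k_rep.
have Zc f : (forall n, inner H f (zeta n) = 0) -> f = 0.
  exact: (monomials_complete hs k_eval k_rep).
split=> [s2|s6]; first exact: (subnormal_of_le2 hs k_rep Z Zc s2).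
split; first exact: (coordinate_multiplication hs k_rep Z Zc).
exact: (not_subnormal_of_ge6 hs Z s6).
Qed.
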